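(* Let $\alpha=\{\alpha_x\}_{x\in P}$ be an $\mathrm{E}$-semigroup over $P$ on $B(H)$. Suppose that for every $x\in P$, $\alpha_x$ leaves the algebra of compact operators invariant, i.e. $\alpha_x(\mathcal{K}(H))\subseteq\mathcal{K}(H)$. Then there exist a strongly continuous family $\{V_x\}_{x\in P}$ of isometries on $H$ and a strictly upper triangular $d\times d$ real matrix $A$ such that (1) for all $x\in P$ and $T\in B(H)$, $\alpha_x(T)=V_xTV_x^*$; and (2) for all $x,y\in P$, $V_xV_y=e^{i\langle Ax|y\rangle}V_{x+y}$.
   Context: $P\subset\mathbb{R}^d$ is a closed convex cone which is spanning ($P-P=\mathbb{R}^d$) and pointed ($P\cap -P=\{0\}$). $H$ is an infinite-dimensional separable complex Hilbert space, $B(H)$ its bounded operators, $\mathcal{K}(H)$ its compact operators. $\langle\cdot|\cdot\rangle$ on $\mathbb{R}^d$ is the standard inner product. An $\mathrm{E}$-semigroup over $P$ on $B(H)$ is a family $\{\alpha_x\}_{x\in P}$ of normal (not necessarily unital) $*$-endomorphisms of $B(H)$ such that $\alpha_0=\mathrm{Id}$, $\alpha_x\circ\alpha_y=\alpha_{x+y}$ for all $x,y\in P$, and for every $\rho$ in the predual of $B(H)$ and every $m\in B(H)$ the map $P\ni x\mapsto\rho(\alpha_x(m))\in\mathbb{C}$ is continuous. *)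

(* Defs.v *)
From HB Require Import structures.
From mathcomp Require Import all_boot all_order all_algebra sesquilinear complex.
From mathcomp Require Import all_classical all_reals all_analysis.

Set Implicit Arguments.
Unset Strict Implicit.
Unset Printing Implicit Defensive.

Import Order.TTheory GRing.Theory Num.Theory.
Import numFieldNormedType.Exports.

Local Open Scope classical_set_scope.
Local Open Scope ring_scope.

(* The inner product is linear in its first argument, conjugate-linear in the
   second.  Convergence and continuity of complex numbers are always stated in
   R[i]^o, because R[i] itself carries no topology in the library. *)
HB.mixin Record CompleteNormedModule_isHilbert (R : realType) H
    of CompleteNormedModule R[i] H := {
  inner : {dot H for (@Num.conj R[i])} ;
  inner_norm : forall x : H, inner x x = `|x| ^+ 2
}.

#[short(type="hilbertType")]
HB.structure Definition Hilbert (R : realType) :=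
  {H of CompleteNormedModule R[i] H & CompleteNormedModule_isHilbert R H}.

Section HilbertSpace.
Context {R : realType}.
Implicit Type H : hilbertType R.

Definition separable H :=
  exists D : set H, countable D /\ dense (D : set (H : topologicalType)).

Definition finite_dimensional H :=
  exists (n : nat) (e : 'I_n -> H), forall x : H,
    exists c : 'I_n -> R[i], x = \sum_(i < n) c i *: e i.

End HilbertSpace.

Section BoundedOperators.
Context {R : realType}.
Variable H : hilbertType R.

Definition bounded_linear : {pred H -> H} := fun f =>
  `[< linear f /\ exists M : R[i], forall x, `|f x| <= M * `|x| >].

Record boundedOp := BoundedOp
  { bop_fun :> H -> H; bop_subproof : bop_fun \in bounded_linear }.

HB.instance Definition _ := [isSub for bop_fun].
HB.instance Definition _ := [Choice of boundedOp by <:].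

Lemma bounded_linear_submod : submod_closed bounded_linear.
Proof.
split=> [|a f g /asboolP[linf [M fM]] /asboolP[ling [N gN]]]; apply/asboolP.
  split=> [b x y|]; first by rewrite -[RHS]/(b *: 0 + 0) scaler0 addr0.
  by exists 0 => x; rewrite normr0 mul0r.
split=> [b x y|].
  rewrite -[LHS]/(a *: f (b *: x + y) + g (b *: x + y)).
  rewrite -[RHS]/(b *: (a *: f x + g x) + (a *: f y + g y)).
  rewrite linf ling !scalerDr !scalerA [a * b]mulrC -!addrA.
  by congr (_ + _); rewrite addrCA.
exists (`|a| * M + N) => x; rewrite mulrDl -mulrA.
apply: (le_trans (ler_normD _ _)); rewrite normrZ.
by apply: lerD; [exact: ler_wpM2l|exact: gN].
Qed.

HB.instance Definition _ := GRing.isSubmodClosed.Build R[i] (H -> H)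
  bounded_linear bounded_linear_submod.
HB.instance Definition _ := [SubChoice_isSubLmodule of boundedOp by <:].

Lemma bounded_linear_id : idfun \in bounded_linear.
Proof. by apply/asboolP; split=> //; exists 1 => x; rewrite mul1r. Qed.

Lemma bounded_linear_comp (S T : boundedOp) : S \o T \in bounded_linear.
Proof.
case: S T => [f /= f_bl] [g /= g_bl].
have /asboolP[linf [M fM]] := f_bl; have /asboolP[ling [N gN]] := g_bl.
apply/asboolP; split=> [b x y|]; first by rewrite /= ling linf.
exists (`|M| * `|N|) => x /=.
have le_norm (K : R[i]) (y z : H) : `|y| <= K * `|z| -> `|y| <= `|K| * `|z|.
  move=> yK; have K0 : 0 <= K * `|z| by apply: le_trans yK.
  by rewrite -(normr_id z) -normrM ger0_norm.
rewrite -mulrA; apply: (le_trans (le_norm _ _ _ (fM _))).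
by apply: ler_wpM2l => //; exact: le_norm.
Qed.

Definition bop_one := BoundedOp bounded_linear_id.
Definition bop_mul (S T : boundedOp) := BoundedOp (bounded_linear_comp S T).

Lemma bop_linear (S : boundedOp) : linear S.
Proof. by case: S => f /= f_bl; have /asboolP[] := f_bl. Qed.

Lemma bop_mulA : associative bop_mul. Proof. by move=> S T U; apply/val_inj. Qed.
Lemma bop_mul1l : left_id bop_one bop_mul. Proof. by move=> S; apply/val_inj. Qed.
Lemma bop_mul1r : right_id bop_one bop_mul. Proof. by move=> S; apply/val_inj. Qed.
Lemma bop_mulDl : left_distributive bop_mul +%R.
Proof. by move=> S T U; apply/val_inj. Qed.
Lemma bop_mulDr : right_distributive bop_mul +%R.
Proof.
move=> S T U; apply/val_inj/funext => x /=.
by have := bop_linear S 1 (T x) (U x); rewrite !scale1r.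
Qed.

(* The product of B(H) is composition. *)
HB.instance Definition _ := GRing.Zmodule_isPzRing.Build boundedOp
  bop_mulA bop_mul1l bop_mul1r bop_mulDl bop_mulDr.

(* The adjoint: the operator S picked here exists and is unique by the Riesz
   representation theorem. *)
Definition adjoint (T : boundedOp) : boundedOp :=
  xget 0 [set S : boundedOp | forall x y, inner (T x) y = inner x (S y)].

Definition compact_operator (T : boundedOp) : Prop :=
  precompact ((T @` [set x : H | `|x| <= 1]) : set H).

Definition is_isometry (V : boundedOp) : Prop := forall x, `|V x| = `|x|.

(* The predual of B(H), as the space of functionals
   T |-> \sum_n <T (xi n) | eta n> with xi and eta square-summable. *)
Definition predual : set (boundedOp -> R[i]) := [set rho |
  exists xi eta : nat -> H,
  [/\ cvgn (series (fun n => `|xi n| ^+ 2 : R[i]^o)),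
      cvgn (series (fun n => `|eta n| ^+ 2 : R[i]^o)) &
      forall T : boundedOp,
        series (fun n => inner (T (xi n)) (eta n) : R[i]^o) @ \oo
          --> (rho T : R[i]^o)]].

(* B(H) with the sigma-weak (ultraweak) topology: the coarsest one making all
   elements of the predual continuous. *)
Definition predual_eval (T : boundedOp) : {ptws predual -> R[i]^o} :=
  fun rho => val rho T.
Definition sigma_weak := initial_topology predual_eval.

Definition normal_map (a : boundedOp -> boundedOp) : Prop :=
  continuous (a : sigma_weak -> sigma_weak).

Definition star_endomorphism (a : boundedOp -> boundedOp) : Prop :=
  [/\ linear a, {morph a : S T / S * T} & {morph a : T / adjoint T}].

End BoundedOperators.

Section Cones.
Context {R : realType} {d : nat}.
Implicit Type P : set 'cV[R]_d.

Definition dotv (x y : 'cV[R]_d) : R := \sum_(i < d) x i 0 * y i 0.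

Definition convex_cone P : Prop :=
  [/\ P !=set0,
      (forall (t : R) x, 0 <= t -> P x -> P (t *: x)) &
      (forall (t : R) x y, 0 <= t <= 1 -> P x -> P y ->
        P (t *: x + (1 - t) *: y))].

Definition spanning P : Prop := [set x - y | x in P & y in P] = setT.

Definition pointed P : Prop := P `&` [set - x | x in P] = [set 0].

Definition strictly_upper_triangular (A : 'M[R]_d) : Prop :=
  forall i j : 'I_d, (j <= i)%N -> A i j = 0.

(* The complex exponential e^(i t) for real t. *)
Definition expi (t : R) : R[i] := (cos t +i* sin t)%C.

End Cones.

(* Semigroups over P are encoded as families indexed by all of R^d, of which
   only the values on P are constrained. *)
Record E_semigroup (R : realType) (H : hilbertType R) (d : nat)
    (P : set 'cV[R]_d) (alpha : 'cV[R]_d -> boundedOp H -> boundedOp H) : Prop := {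
  E_semigroup_star : forall x, P x -> star_endomorphism (alpha x) ;
  E_semigroup_normal : forall x, P x -> normal_map (alpha x) ;
  E_semigroup0 : alpha 0 = id ;
  E_semigroupD : forall x y, P x -> P y -> alpha x \o alpha y = alpha (x + y) ;
  E_semigroup_continuous : forall rho (m : boundedOp H), predual rho ->
    {within P, continuous (fun x => rho (alpha x m) : R[i]^o)}
}.

Definition strongly_continuous_on (R : realType) (H : hilbertType R) (d : nat)
    (P : set 'cV[R]_d) (V : 'cV[R]_d -> boundedOp H) : Prop :=
  forall xi : H, {within P, continuous (fun x => V x xi)}.

(* Main.v *)
(* For a minimal projection e the projection alpha_x(e) is compact, hence of finite
   rank r(x), and r(x) = r(x / 2^n)^(2^n) for all n forces r(x) = 1; together with
   normality this yields isometries U_x, unique up to a phase, with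
   alpha_x(T) = U_x T U_x^*.  The commutator phases of U_{sv} and U_{tw} are
   bicharacters exp(i k s t), trivial for v = w.  Along a ray the phases can then
   be chosen so that U_{sv} U_{tv} is uniformly close to U_{(s+t)v}; the bounded
   real cocycle obtained by taking arguments is a coboundary (Hyers' series), and
   we get a genuine continuous semigroup on each ray.  Ordered products of such
   semigroups along a basis contained in P give a multiplier of exponential type
   on a simplicial cone Q.  Since x + y lies in Q for some y in Q, the relation
   V_x V_y = exp(i phi(x, y)) V_{x+y} determines V_x for all x in P.  Subtracting
   a symmetric form, a coboundary, makes phi strictly upper triangular. *)

Require Import Defs.
From mathcomp Require Import all_boot all_order all_algebra complex.
From mathcomp Require Import ring lra.
From mathcomp Require Import all_classical all_reals all_analysis.

Set Implicit Arguments.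
Unset Strict Implicit.
Unset Printing Implicit Defensive.

Import Order.TTheory GRing.Theory Num.Theory.
Import numFieldNormedType.Exports.

Local Open Scope classical_set_scope.
Local Open Scope ring_scope.

(** * Hilbert spaces and bounded operators *)

(** Each [U x] is fixed only up to a phase, chosen separately for every x, so [x |-> U x] has no
    continuity to start from. What is continuous is free of phases: [alpha] itself and the
    commutators. Requiring <U_x u|u> >= 0 for one unit vector u recovers continuity, but only at 0
    along rays, where |<U_x u|u>|^2 = <alpha_x(|u><u|) u|u> tends to 1; farther out the inner
    product may vanish and then pins nothing. Large parameters are therefore reached by Euclidean
    division by a small step, at the price of a cocycle that is close to 1 rather than equal to 1.
    Closeness makes arguments usable: on the right half of the circle they are given by asin, and
    small ones add up without multiples of 2 pi. Hyers' series corrects only the diagonal s = t. The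
    remaining discrepancy D satisfies D(2s, 2t) = D(s, t)^2 and keeps a positive real part, and a
    point of the circle all of whose 2^n-th powers have positive real part is 1. The same rigidity
    shows that characters of the half-line are exponentials. *)

Section NormedConvergence.
Context {K : numFieldType} {V : pseudoMetricNormedZmodType K}.

Lemma cvg_dist_le {T : Type} {F : set_system T} {FF : Filter F}
    (f : T -> V) (l : V) (g : T -> K) :
  (\forall t \near F, `|l - f t| <= g t) ->
  g @ F --> (0 : K^o) -> f @ F --> l.
Proof.
move=> fg g0; apply/cvgrPdist_lt => e e0.
have /cvgr0Pnorm_lt/(_ _ e0) g0e := g0.
near=> t; apply: (@le_lt_trans _ _ `|g t|).
  have fgt : `|l - f t| <= g t by near: t.
  by rewrite ger0_norm//; exact: le_trans fgt.
by near: t.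
Unshelve. all: by end_near. Qed.

Lemma cvg_dist0 {T : Type} {F : set_system T} {FF : Filter F} (f : T -> V) (l : V) :
  f @ F --> l -> (fun t => `|l - f t|) @ F --> (0 : K^o).
Proof.
move=> /cvgrPdist_lt fl; apply/cvgr0Pnorm_lt => e e0.
by near do rewrite normr_id; exact: fl.
Unshelve. all: by end_near. Qed.

Lemma cvg_mull0 {T : Type} {F : set_system T} {FF : Filter F} (c : K) (g : T -> K) :
  g @ F --> (0 : K^o) -> (fun t => c * g t) @ F --> (0 : K^o).
Proof.
move=> g0; have cc : (fun=> c) @ F --> (c : K^o) by apply: (@cvg_cst K^o).
by have := @cvgM _ _ _ FF _ _ _ _ cc g0; rewrite mulr0.
Qed.

End NormedConvergence.

Section InnerProduct.
Context {R : realType} {H : hilbertType R}.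
Implicit Types (x y z : H) (a : R[i]).

Lemma innerC x y : inner x y = (inner y x)^*.
Proof. by rewrite (hermC inner) mul1r. Qed.

Lemma innerDl x y z : inner (x + y) z = inner x z + inner y z.
Proof. exact: linearDl. Qed.

Lemma innerDr x y z : inner x (y + z) = inner x y + inner x z.
Proof. exact: linearDr. Qed.

Lemma innerNl x y : inner (- x) y = - inner x y.
Proof. exact: linearNl. Qed.

Lemma innerNr x y : inner x (- y) = - inner x y.
Proof. exact: linearNr. Qed.

Lemma innerBl x y z : inner (x - y) z = inner x z - inner y z.
Proof. exact: linearBl. Qed.

Lemma innerBr x y z : inner x (y - z) = inner x y - inner x z.
Proof. exact: linearBr. Qed.

Lemma inner0l x : inner 0 x = 0. Proof. exact: linear0l. Qed.

Lemma inner0r x : inner x 0 = 0. Proof. exact: linear0r. Qed.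

Lemma innerZl a x y : inner (a *: x) y = a * inner x y.
Proof. exact: linearZl_LR. Qed.

Lemma innerZr a x y : inner x (a *: y) = a^* * inner x y.
Proof. exact: linearZr_LR. Qed.

Lemma inner_eq0 x : inner x x = 0 -> x = 0.
Proof.
by move=> /eqP; rewrite inner_norm expf_eq0/= normr_eq0 => /eqP.
Qed.

Lemma inner_injr x y : (forall z, inner z x = inner z y) -> x = y.
Proof.
by move=> xy; apply/subr0_eq/inner_eq0; rewrite innerBr xy subrr.
Qed.

Lemma cauchy_schwarz x y : `|inner x y| <= `|x| * `|y|.
Proof.
have [->|y0] := eqVneq y 0; first by rewrite inner0r !normr0 mulr0.
have ny : 0 < `|y| by rewrite normr_gt0.
have nyC : (`|y| ^+ 2)^* = `|y| ^+ 2.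
  by apply: geC0_conj; rewrite exprn_ge0.
have ny2 : `|y| ^+ 2 != 0 by rewrite expf_neq0// gt_eqF.
set c := inner x y / `|y| ^+ 2.
have cc : inner (x - c *: y) (x - c *: y)
    = `|x| ^+ 2 - `|inner x y| ^+ 2 / `|y| ^+ 2.
  rewrite innerBl !innerBr !innerZl !innerZr !inner_norm (innerC y x).
  rewrite normCK /c rmorphM fmorphV /= nyC.
  move: (inner x y) ny2 => u; set v := u^*; set w := `|y| ^+ 2 => w0.
  by field.
have : 0 <= `|x| ^+ 2 - `|inner x y| ^+ 2 / `|y| ^+ 2.
  by rewrite -cc inner_norm exprn_ge0.
rewrite subr_ge0 ler_pdivrMr ?exprn_gt0// -exprMn.
by rewrite ler_pXn2r// nnegrE ?mulr_ge0.
Qed.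

Lemma cvg_inner {T : Type} {F : set_system T} {FF : Filter F} (f g : T -> H) x y :
  f @ F --> x -> g @ F --> y ->
  (fun t => inner (f t) (g t) : R[i]^o) @ F --> (inner x y : R[i]^o).
Proof.
move=> fx gy.
apply: (@cvg_dist_le _ _ _ _ _ _ _
  (fun t => `|x - f t| * `|g t| + `|x| * `|y - g t|)).
  near=> t; rewrite -[_ - _](_ : inner (x - f t) (g t) + inner x (y - g t) = _).
    by rewrite (le_trans (ler_normD _ _))// lerD// cauchy_schwarz.
  by rewrite innerBl innerBr addrC addrA subrK.
have nf := cvg_dist0 (FF := FF) fx.
have ng := cvg_dist0 (FF := FF) gy.
have ny : (fun t => `|g t|) @ F --> (`|y| : R[i]^o) by exact: cvg_norm.
have := @cvgD _ _ _ _ FF _ _ _ _ (@cvgM _ _ _ FF _ _ _ _ nf ny)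
  (cvg_mull0 (FF := FF) `|x| ng).
by rewrite mul0r addr0.
Unshelve. all: by end_near. Qed.

Lemma parallelogram x y :
  `|x + y| ^+ 2 + `|x - y| ^+ 2 = 2 * (`|x| ^+ 2 + `|y| ^+ 2).
Proof.
rewrite -!inner_norm !(innerDl, innerDr, innerNl, innerNr).
set a := inner x x; set b := inner x y; set c := inner y x; set e := inner y y.
by ring.
Qed.

End InnerProduct.

Section RealComplex.
Context {R : realType}.

Lemma RReK (x : R[i]) : x \is Num.real -> (complex.Re x)%:C%C = x.
Proof. exact: RRe_real. Qed.

Lemma lecRE (x y : R) : (x%:C%C <= y%:C%C) = (x <= y).
Proof. exact: lecR. Qed.

Lemma ltcRE (x y : R) : (x%:C%C < y%:C%C) = (x < y).
Proof. exact: ltcR. Qed.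

(** Positivity in [R[i]] entails being real, so the complex radii of the norm topology can be traded
    for real ones. *)
Lemma real_complex_eps (e : R[i]) : 0 < e -> exists2 r : R, 0 < r & e = r%:C%C.
Proof.
move=> e0; have eK := RReK (gtr0_real e0).
by exists (complex.Re e); rewrite // -ltcRE eK.
Qed.

Lemma Re_le_norm (c : R[i]) : complex.Re c <= complex.Re `|c|.
Proof.
rewrite -lecRE (RReK (normr_real c)); apply: le_trans (normc_ge_Re c).
by rewrite lecRE ler_norm.
Qed.

Lemma norm_real_complex (x : R) : `|x%:C%C| = `|x|%:C%C.
Proof. by rewrite normc_def /= expr0n /= addr0 sqrtr_sqr. Qed.

Lemma cvg_real_complex {T : Type} {F : set_system T} {FF : Filter F}
    (f : T -> R) (l : R) :
  f @ F --> l -> (fun t => (f t)%:C%C) @ F --> (l%:C%C : R[i]^o).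
Proof.
move=> /cvgrPdist_lt fl.
apply/(@cvgrPdist_lt R[i] R[i]^o) => e /real_complex_eps[r r0 ->].
have := fl _ r0; apply: filterS => t.
by rewrite -rmorphB norm_real_complex ltcRE.
Qed.

Lemma cvg_complexRe {T : Type} {F : set_system T} {FF : Filter F}
    (f : T -> R[i]) (l : R[i]) :
  f @ F --> (l : R[i]^o) -> (fun t => complex.Re (f t)) @ F --> complex.Re l.
Proof.
move=> /(@cvgrPdist_lt R[i] R[i]^o) fl; apply/cvgrPdist_lt => e e0.
have := fl e%:C%C; rewrite ltcR => /(_ e0); apply: filterS => t.
rewrite -ltcRE; apply: le_lt_trans; rewrite -raddfB.
exact: normc_ge_Re.
Qed.

Lemma cvg_complex_unique {T : Type} {F : set_system T} {FF : ProperFilter F}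
    (f : T -> R[i]) (a b : R[i]) :
  f @ F --> (a : R[i]^o) -> f @ F --> (b : R[i]^o) -> a = b.
Proof. exact: (@cvg_unique R[i]^o). Qed.

Lemma cvg_complex_conj {I : Type} {F : set_system I} {FF : Filter F}
    (f : I -> R[i]) (l : R[i]) :
  f @ F --> (l : R[i]^o) -> (fun i => (f i)^*) @ F --> (l^* : R[i]^o).
Proof.
move=> fl; apply: (@cvg_dist_le _ R[i]^o _ _ _ _ _ (fun i => `|l - f i|)).
  by near=> i; rewrite -rmorphB norm_conjC.
exact: (@cvg_dist0 R[i] R[i]^o _ _ _ f _ fl).
Unshelve. all: by end_near. Qed.

End RealComplex.

Section Riesz.
Context {R : realType} {H : hilbertType R}.

(** Variational proof: [j x] is |x|^2 - 2 Re f(x), bounded below, and the parallelogram law makes a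
    minimizing sequence Cauchy. Its limit [z] represents [f], since otherwise a small step in a
    suitable direction would lower [j]. *)
Lemma riesz (f : H -> R[i]) (M : R[i]) : scalar f -> (forall x, `|f x| <= M * `|x|) ->
  exists z, forall x, f x = inner x z.
Proof.
move=> linf fM.
have fD x y : f (x + y) = f x + f y by have := linf 1 x y; rewrite scale1r mul1r.
have f0 : f 0 = 0 by apply: (addrI (f 0)); rewrite -fD !addr0.
have fZ a x : f (a *: x) = a * f x by have := linf a x 0; rewrite f0 !addr0.
have fN x : f (- x) = - f x by rewrite -scaleN1r fZ mulN1r.
have fM' x : `|f x| <= `|M| * `|x|.
  have Mx : 0 <= M * `|x| by exact: le_trans (fM x).
  by rewrite -[`|x| in leRHS]normr_id -normrM (ger0_norm Mx).
pose j x : R[i] := `|x| ^+ 2 - (f x + (f x)^*).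
pose J x : R := complex.Re (j x).
have jr x : j x \is Num.real.
  by rewrite CrealE /j rmorphB rmorphD /= conjCK (addrC (f x)) rmorphXn /=
    (geC0_conj (normr_ge0 _)).
have jJ x : j x = (J x)%:C%C by rewrite /J RReK.
have para x y : `|x - y| ^+ 2 = 2 * j x + 2 * j y - 4 * j (2^-1 *: (x + y)).
  have h : `|2^-1 *: (x + y)| ^+ 2 = `|x + y| ^+ 2 / 4.
    by rewrite normrZ exprMn normrV ?unitfE// normr_nat mulrC; field.
  have := parallelogram x y; move=> /(canRL (addKr _)) ->.
  rewrite /j h fZ fD rmorphM rmorphD fmorphV /= conjC_nat; by field.
have lb : has_inf [set J x | x in setT].
  split; first by exists (J 0); exists 0.
  (* Completing the square: [j x] exceeds -|M|^2 by at least (|x| - |M|)^2. *)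
  exists (complex.Re (- `|M| ^+ 2)) => _ [x _ <-].
  rewrite -lecRE -jJ RReK ?rpredN ?rpredX ?normr_real// /j.
  have fx : f x + (f x)^* <= 2 * (`|M| * `|x|).
        have : f x + (f x)^* <= `|f x + (f x)^*|.
      by rewrite real_ler_norm// CrealE rmorphD /= conjCK addrC.
    move=> /le_trans; apply; rewrite (le_trans (ler_normD _ _))//.
    by rewrite norm_conjC -mulr2n mulr_natl lerMn2r fM' orbT.
  rewrite -subr_ge0 opprK; apply: (@le_trans _ _ ((`|x| - `|M|) ^+ 2)).
    by rewrite real_exprn_even_ge0// rpredB// normr_real.
  rewrite -subr_ge0 [X in 0 <= X](_ : _ = 2 * (`|M| * `|x|) - (f x + (f x)^*)).
    by rewrite subr_ge0.
  by ring.
set m := inf [set J x | x in setT] in lb.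
have mJ x : m <= J x by apply: inf_lbound; [exact: lb.2|exists x].
have /choice[u uJ] : forall n : nat, exists x, J x < m + n.+1%:R^-1.
  move=> n; have [|_ [x _ <-] xm] := @inf_adherent _ _ n.+1%:R^-1 _ lb.
    by rewrite invr_gt0.
  by exists x.
have near_min x y (a b : R) : J x <= m + a -> J y <= m + b ->
    `|x - y| ^+ 2 <= (2 * (a + b))%:C%C.
  move=> xa yb; rewrite para; set w := 2^-1 *: _.
  rewrite !jJ -(rmorph_nat (real_complex R) 2).
  rewrite -(rmorph_nat (real_complex R) 4) -!rmorphM -!rmorphD -rmorphB lecRE.
  have := mJ w; lra.
have cu : cvg (u @ \oo).
  apply/cauchy_cvgP/cauchy_exP => e /= /real_complex_eps[r r0 ->].
  have r24 : 0 < r ^+ 2 / 4 by rewrite divr_gt0// exprn_gt0.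
  have [N Nr] : exists N : nat, N.+1%:R^-1 < r ^+ 2 / 4.
    exists (Num.truncn (r ^+ 2 / 4)^-1); rewrite invf_plt ?posrE//.
    exact: truncnS_gt.
  exists (u N); exists N => // n /= Nn; rewrite -ball_normE /=.
  rewrite -(@ltr_pXn2r _ 2)// ?nnegrE ?normr_ge0// ?ler0c ?ltW//.
  apply: (le_lt_trans (near_min _ _ _ _ (ltW (uJ N)) (ltW (uJ n)))).
  rewrite -rmorphXn ltcRE.
  have : n.+1%:R^-1 <= N.+1%:R^-1 :> R by rewrite lef_pV2 ?posrE// ler_nat.
  by move: (N.+1%:R^-1) (n.+1%:R^-1) Nr => p q; lra.
set z := lim (u @ \oo).
have fc : (f \o u) @ \oo --> (f z : R[i]^o).
  apply: (@cvg_dist_le _ R[i]^o _ _ _ _ _ (fun n => `|M| * `|z - u n|)).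
    by near=> n; rewrite /= -fN -fD.
  by apply: cvg_mull0; exact: cvg_dist0.
have jc : (j \o u) @ \oo --> (j z : R[i]^o).
  have nz : (fun n => `|u n|) @ \oo --> (`|z| : R[i]^o) by exact: cvg_norm.
  have fcC : (fun n => (f (u n))^*) @ \oo --> ((f z)^* : R[i]^o).
    exact: cvg_complex_conj fc.
  have := @cvgB _ R[i]^o _ _ _ _ _ _ _ (cvgM nz nz) (@cvgD _ R[i]^o _ _ _ _ _ _ _ fc fcC).
  by apply.
have jm : (j \o u) @ \oo --> (m%:C%C : R[i]^o).
  apply: (@cvg_dist_le _ R[i]^o _ _ _ _ _ (fun n => (n.+1%:R^-1)%:C%C)).
    near=> n; have e : (J (u n))%:C%C - m%:C%C = (J (u n) - m)%:C%C.
      by rewrite rmorphB.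
    by rewrite /comp jJ distrC e ger0_norm ?ler0c ?subr_ge0// lecRE lerBlDl ltW.
  exact: (cvg_real_complex cvg_harmonic).
have zm : j z = m%:C%C by exact: cvg_complex_unique jc jm.
exists z => v; pose c : R[i] := f v - inner v z.
suff c0 : c = 0 by apply/eqP; rewrite -subr_eq0 -/c c0.
have fvE : f v = c + inner v z by rewrite subrK.
clearbody c.
(* The step [s * c^* *: v] changes [j] by -2 s |c|^2 to first order. This [s] keeps s |v|^2 below 1,
   so the second-order term cannot make up for it. *)
pose s : R[i] := (`|v| ^+ 2 + 1)^-1.
have s0 : 0 < s by rewrite invr_gt0 ltr_wpDl// exprn_ge0.
have jzv : j (z + s * c^* *: v) - j z
    = s * `|c| ^+ 2 * (s * `|v| ^+ 2 - 2).
  rewrite /j fD fZ -!inner_norm innerDl !innerDr !innerZl !innerZr normCK.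
  rewrite fvE (innerC z v) !(rmorphD, rmorphM) /= conjCK (geC0_conj (ltW s0)).
  by ring.
have : 0 <= j (z + s * c^* *: v) - j z by rewrite zm jJ subr_ge0 lecRE.
rewrite jzv -mulrA pmulr_rge0// => h.
have sv : s * `|v| ^+ 2 - 2 < 0.
  have w0 : 0 < `|v| ^+ 2 + 1 by rewrite ltr_wpDl// exprn_ge0.
  rewrite subr_lt0 (@lt_trans _ _ 1) ?ltr1n// mulrC.
  by rewrite (ltr_pdivrMr _ _ w0) mul1r ltrDl.
move: h; rewrite nmulr_lge0// => c0.
have : `|c| ^+ 2 == 0 by rewrite eq_le c0 exprn_ge0.
by rewrite expf_eq0/= normr_eq0 => /eqP.
Unshelve. all: by end_near. Qed.

End Riesz.

Section BoundedOperators.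
Context {R : realType} {H : hilbertType R}.
Implicit Types (S T V W : boundedOp H) (x y z : H).

Lemma bop_ext S T : (forall x, S x = T x) -> S = T.
Proof. by move=> ST; apply/val_inj/funext. Qed.

Lemma bopD T x y : T (x + y) = T x + T y.
Proof. by have := bop_linear T 1 x y; rewrite !scale1r. Qed.

Lemma bop0 T : T 0 = 0.
Proof. by apply: (addrI (T 0)); rewrite -bopD !addr0. Qed.

Lemma bopZ T a x : T (a *: x) = a *: T x.
Proof. by have := bop_linear T a x 0; rewrite bop0 !addr0. Qed.

Lemma bopN T x : T (- x) = - T x.
Proof. by rewrite -scaleN1r bopZ scaleN1r. Qed.

Lemma bopB T x y : T (x - y) = T x - T y.
Proof. by rewrite bopD bopN. Qed.

Lemma bop_addE S T x : (S + T) x = S x + T x. Proof. by []. Qed.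

Lemma bop_mulE S T x : (S * T) x = S (T x). Proof. by []. Qed.

Lemma bop_scaleE a T x : (a *: T) x = a *: T x. Proof. by []. Qed.

Lemma bop_scaleAl a S T : (a *: S) * T = a *: (S * T).
Proof. by apply: bop_ext. Qed.

Lemma bop_scaleAr a S T : S * (a *: T) = a *: (S * T).
Proof. by apply: bop_ext => x /=; rewrite bopZ. Qed.

Lemma bop_bounded T : exists2 M : R[i], 0 <= M & forall x, `|T x| <= M * `|x|.
Proof.
case: T => f /= f_bl; have /asboolP[_ [M fM]] := f_bl; exists `|M| => // x.
have Mx : 0 <= M * `|x| by exact: le_trans (fM x).
by rewrite -[`|x| in leRHS]normr_id -normrM (ger0_norm Mx).
Qed.

Lemma mk_boundedOp (f : H -> H) (M : R[i]) : linear f ->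
  (forall x, `|f x| <= M * `|x|) -> exists T : boundedOp H, forall x, T x = f x.
Proof.
move=> lf fM.
have bf : f \in bounded_linear (H := H) by apply/asboolP; split => //; exists M.
by exists (BoundedOp bf).
Qed.

(** Riesz representation for each [y] separately; the norm bound comes from |S y|^2 = <T S y |
    y>. *)
Lemma adjoint_exists T : exists S, forall x y, inner (T x) y = inner x (S y).
Proof.
have [M M0 TM] := bop_bounded T.
have /choice[f fT] : forall y, exists z, forall x, inner (T x) y = inner x z.
  move=> y; apply: (@riesz _ _ (fun x => inner (T x) y) (M * `|y|)).
    by move=> a u v; rewrite bopD bopZ innerDl innerZl.
  move=> x; rewrite (le_trans (cauchy_schwarz _ _))// mulrAC.
  by rewrite ler_wpM2r.
have [S SE] : exists S : boundedOp H, forall x, S x = f x.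
  apply: (@mk_boundedOp f M) => [a u v|y].
    apply: inner_injr => x; rewrite innerDr innerZr -!fT innerDr innerZr.
    by [].
  have [->|fy] := eqVneq (f y) 0; first by rewrite normr0 mulr_ge0.
  have ny : 0 < `|f y| by rewrite normr_gt0.
  rewrite -(ler_pM2l ny) -expr2 -inner_norm -fT -[leLHS]ger0_norm; last first.
    by rewrite fT inner_norm exprn_ge0.
  rewrite (le_trans (cauchy_schwarz _ _))// mulrA ler_wpM2r// mulrC.
  by rewrite (le_trans (TM _))// mulrC.
by exists S => x y; rewrite fT SE.
Qed.

Lemma adjointP T x y : inner (T x) y = inner x (adjoint T y).
Proof.
exact: (xgetPex 0 (adjoint_exists T)).
Qed.

Lemma adjointPr T x y : inner x (T y) = inner (adjoint T x) y.
Proof. by rewrite innerC adjointP -innerC. Qed.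

Lemma adjoint_unique T S :
  (forall x y, inner (T x) y = inner x (S y)) -> adjoint T = S.
Proof.
by move=> TS; apply: bop_ext => y; apply: inner_injr => x; rewrite -adjointP.
Qed.

Lemma adjointM S T : adjoint (S * T) = adjoint T * adjoint S.
Proof. by apply: adjoint_unique => x y /=; rewrite !adjointP. Qed.

Lemma adjointZ a T : adjoint (a *: T) = a^* *: adjoint T.
Proof.
apply: adjoint_unique => x y.
by rewrite !bop_scaleE innerZl innerZr conjCK adjointP.
Qed.

Lemma rank_one_subproof (a b : H) : (fun x => inner x b *: a) \in bounded_linear (H := H).
Proof.
apply/asboolP; split => [c x y|]; first by rewrite innerDl innerZl scalerDl scalerA.
exists (`|b| * `|a|) => x; rewrite normrZ mulrAC ler_wpM2r//.
by rewrite mulrC cauchy_schwarz.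
Qed.

(** The operator |a><b|. For a unit vector [u], [rank_one u u] is a minimal projection. *)
Definition rank_one a b : boundedOp H := BoundedOp (rank_one_subproof a b).

Lemma rank_oneE a b x : rank_one a b x = inner x b *: a. Proof. by []. Qed.

Lemma rank_one_mul a b c e :
  rank_one a b * rank_one c e = inner c b *: rank_one a e.
Proof.
apply: bop_ext => x; rewrite bop_mulE bop_scaleE !rank_oneE innerZl scalerA.
by rewrite mulrC.
Qed.

Lemma bop_mul_rank_one T a b : T * rank_one a b = rank_one (T a) b.
Proof. by apply: bop_ext => x; rewrite bop_mulE !rank_oneE bopZ. Qed.

Lemma adjoint_rank_one a b : adjoint (rank_one a b) = rank_one b a.
Proof.
apply: adjoint_unique => x y; rewrite !rank_oneE innerZl innerZr -innerC.
by rewrite mulrC.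
Qed.

(** Polarization: norms of sums determine the real part of [inner x y], and replacing [x] by i x
    gives the imaginary part. *)
Lemma isometry_inner V : is_isometry V <->
  forall x y, inner (V x) (V y) = inner x y.
Proof.
split=> [iV x y|VV x]; last first.
  by apply/eqP; rewrite -(@eqrXn2 _ 2)// -!inner_norm VV.
have n2 z : inner (V z) (V z) = inner z z by rewrite !inner_norm iV.
have s u v : inner u v + (inner u v)^* = inner (u + v) (u + v) - inner u u - inner v v.
  by rewrite -innerC innerDl !innerDr; ring.
have re u v : inner (V u) (V v) + (inner (V u) (V v))^* = inner u v + (inner u v)^*.
  by rewrite !s -bopD !n2.
have := re ('i *: x) y; have := re x y.
rewrite bopZ !innerZl !rmorphM /= conjCi => h1 h2.
have h3 : inner (V x) (V y) - (inner (V x) (V y))^* = inner x y - (inner x y)^*.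
  apply: (mulfI (neq0Ci R[i])); rewrite !mulrBr -!mulNr; exact: h2.
have := congr2 +%R h1 h3; rewrite !addrA ![_ + _ + inner _ _]addrAC !addrK.
by rewrite -!mulr2n => /eqP; rewrite eqr_pMn2r// => /eqP.
Qed.

Lemma isometry_adjointK V : is_isometry V -> adjoint V * V = 1.
Proof.
move=> /isometry_inner VV; apply: bop_ext => x; apply: inner_injr => y.
by rewrite bop_mulE -adjointP VV.
Qed.

Lemma isometryM V W : is_isometry V -> is_isometry W -> is_isometry (V * W).
Proof. by move=> iV iW x; rewrite bop_mulE iV iW. Qed.

Lemma isometryZ c V : `|c| = 1 -> is_isometry V -> is_isometry (c *: V).
Proof. by move=> c1 iV x; rewrite bop_scaleE normrZ c1 mul1r. Qed.

End BoundedOperators.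

(** * The sigma-weak topology and normal maps *)

Section SigmaWeak.
Context {R : realType} {H : hilbertType R}.
Implicit Types (S T : boundedOp H) (x y : H).

(** [predual_eval] maps into a product indexed by the predual, so convergence in its initial
    topology is convergence of every coordinate. *)
Lemma sigma_weak_cvg {F : set_system (boundedOp H)} {FF : Filter F} T :
  F --> (T : sigma_weak H) <->
  forall rho, predual rho -> rho @ F --> (rho T : R[i]^o).
Proof.
split=> [FT rho rhoP|FT].
  pose r : set_type (@predual R H) := SigSub (mem_set rhoP).
  have c1 := @initial_continuous _ _ (@predual_eval R H) T.
  have c2 := @proj_continuous (set_type (@predual R H)) (fun=> R[i]^o) r (predual_eval T).
  exact: (cvg_trans (cvg_app _ FT) (cvg_comp _ _ c1 c2)).
have FE : predual_eval (H := H) @ F --> predual_eval T.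
  apply/cvg_sup => r; apply/cvg_image.
    by rewrite eqEsubset; split=> v // _; exists (cst v).
  have := FT (val r) (set_mem (valP r)); apply: cvg_trans => W /=.
  rewrite ?nbhs_simpl /fmap /= => FW.
  exists (@^~ r @^-1` W) => //.
  by rewrite eqEsubset; split => [j [? + <-//]|j Wj]; exists (fun=> j).
move=> A; rewrite nbhsE => -[_ [[B Bop <-] BT] BA].
apply: filterS BA _; apply: FE.
exact: open_nbhs_nbhs.
Qed.

Lemma normal_map_cvg (a : boundedOp H -> boundedOp H) {F : set_system (boundedOp H)}
    {FF : Filter F} T rho : normal_map a -> predual rho ->
  (forall sigma, predual sigma -> sigma @ F --> (sigma T : R[i]^o)) ->
  rho \o a @ F --> (rho (a T) : R[i]^o).
Proof.
move=> na rhoP /sigma_weak_cvg FT.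
have aT : a @ F --> (a T : sigma_weak H) by exact: cvg_comp FT (na T).
exact: ((sigma_weak_cvg (a T)).1 aT).
Qed.

Lemma predual_vector x y : predual (fun T => inner (T x) y).
Proof.
have single (u : nat -> R[i]) : (forall n, u n.+1 = 0) ->
    series u @ \oo --> (u 0%N : R[i]^o).
  move=> u0; apply: (@cvg_near_cst _ R[i]^o); exists 1%N => // -[|n] _ //=.
  by rewrite /series /= big_nat_recl//= big1 ?addr0.
pose at0 (z : H) := fun n : nat => if n is 0%N then z else 0.
have sq z : cvgn (series (fun n => `|at0 z n| ^+ 2 : R[i]^o)).
  apply/cvg_ex; exists (`|z| ^+ 2).
  by apply: (single (fun n => `|at0 z n| ^+ 2)) => n; rewrite normr0 expr0n.
exists (at0 x), (at0 y); split=> // T.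
by apply: (single (fun n => inner (T (at0 x n)) (at0 y n))) => n; rewrite inner0r.
Qed.

(* Dominated convergence for the series defining an element of the predual. *)
Lemma predual_cvg (rho : boundedOp H -> R[i]) (S : nat -> boundedOp H) T (M : R[i]) :
  predual rho -> 0 <= M -> (forall n x, `|S n x - T x| <= M * `|x|) ->
  (forall x, S n x @[n --> \oo] --> T x) ->
  rho \o S @ \oo --> (rho T : R[i]^o).
Proof.
move=> [xi [eta [cxi ceta rhoE]]] M0 SM ST.
have [a0 a0E] : exists a0, a0 = (fun n => `|xi n| ^+ 2 + `|eta n| ^+ 2) by eexists.
have [A cA] : exists A, series a0 @ \oo --> (A : R[i]^o).
  have [l1 c1] := (cvg_ex _).1 cxi; have [l2 c2] := (cvg_ex _).1 ceta.
  exists (l1 + l2).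
  have -> : series a0 = series (fun n => `|xi n| ^+ 2) + series (fun n => `|eta n| ^+ 2).
    by apply/funext => n; rewrite a0E /series /= big_split.
  exact: (@cvgD _ R[i]^o _ _ _ _ _ _ _ c1 c2).
have a0_ge n : 0 <= a0 n by rewrite a0E addr_ge0 ?exprn_ge0.
have amgm n : `|xi n| * `|eta n| <= a0 n.
  rewrite a0E -subr_ge0.
  have : 0 <= (`|xi n| - `|eta n|) ^+ 2.
    by rewrite real_exprn_even_ge0// rpredB ?normr_real.
  move=> /(addr_ge0 (mulr_ge0 (normr_ge0 (xi n)) (normr_ge0 (eta n)))).
  by congr (_ <= _); ring.
apply/(@cvgrPdist_le R[i] R[i]^o) => e e0.
(* Beyond [K] the series contribute at most [M * (2 * e1)], hence at most e / 4. The other three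
   quarters go to the first [K] terms and to the two approximations by partial sums. *)
pose e1 := e / (8 * (M + 1)).
have M1 : 0 < M + 1 by rewrite ltr_wpDl.
have e10 : 0 < e1 by rewrite divr_gt0// mulr_gt0.
have [K _ KA] : \forall n \near \oo, `|A - series a0 n| < e1.
  by move: cA => /(@cvgrPdist_lt R[i] R[i]^o)/(_ _ e10).
pose s n := \sum_(0 <= k < K) `|eta k| * `|T (xi k) - S n (xi k)|.
have s0 : s @ \oo --> (0 : R[i]^o).
  rewrite {}/s; elim: K {KA} => [|K IH].
    by under eq_fun do rewrite big_nil; apply: (@cvg_cst R[i]^o).
  under eq_fun do rewrite big_nat_recr//=.
  have ck := @cvg_mull0 R[i] _ _ _ `|eta K| _ (@cvg_dist0 _ _ _ _ _ _ _ (ST (xi K))).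
  by have := @cvgD R[i] R[i]^o _ _ _ _ _ _ _ IH (ck _ _); rewrite addr0; apply.
have e40 : 0 < e / 4 by rewrite divr_gt0.
have sn : \forall n \near \oo, `|s n| < e / 4.
  by move: s0 => /(@cvgr0Pnorm_lt R[i] R[i]^o)/(_ _ e40).
near=> n.
have sne : `|s n| < e / 4 by near: n.
have [m [Km m1 m2]] : exists m, [/\ (K <= m)%N,
    `|rho (S n) - series (fun k => inner (S n (xi k)) (eta k)) m| < e / 4 &
    `|rho T - series (fun k => inner (T (xi k)) (eta k)) m| < e / 4].
  have r1 := rhoE (S n); have r2 := rhoE T.
  move: r1 => /(@cvgrPdist_lt R[i] R[i]^o)/(_ _ e40) r1.
  move: r2 => /(@cvgrPdist_lt R[i] R[i]^o)/(_ _ e40) r2.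
  near \oo => m; exists m; split; [by near: m; exists K|by near: m|by near: m].
have tail : `|series (fun k => inner (S n (xi k)) (eta k)) m
     - series (fun k => inner (T (xi k)) (eta k)) m| <= `|s n| + e / 4.
  have AmK : `|series a0 m - series a0 K| <= 2 * e1.
    rewrite (_ : _ - _ = (A - series a0 K) - (A - series a0 m)); last by ring.
    rewrite (le_trans (ler_normB _ _))// mulr_natl mulr2n.
    by apply: ltW; apply: ltrD; apply: KA => //=.
  have Me : M * (2 * e1) <= e / 4.
    rewrite (_ : M * _ = e / 4 * (M / (M + 1))); last first.
      by rewrite /e1; field; rewrite gt_eqF.
    by rewrite ler_piMr ?(ltW e40)// ler_pdivrMr// mul1r lerDl.
  have tl : \sum_(K <= k < m) a0 k = series a0 m - series a0 K.
    by rewrite /series/= [in RHS](@big_cat_nat _ _ _ K 0%N m)//= addrAC subrr add0r.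
  have tl0 : 0 <= \sum_(K <= k < m) a0 k by rewrite sumr_ge0.
  rewrite /series/= -sumrB (big_cat_nat (n := K))//=.
  rewrite (le_trans (ler_normD _ _))// lerD//.
    have -> : `|s n| = s n by apply: ger0_norm; apply: sumr_ge0 => k _; rewrite mulr_ge0.
    rewrite (le_trans (ler_norm_sum _ _ _))//; apply: ler_sum => k _.
    by rewrite -innerBl (le_trans (cauchy_schwarz _ _))// mulrC distrC.
  apply: (le_trans (ler_norm_sum _ _ _)); apply: le_trans Me.
  apply: (@le_trans _ _ (M * \sum_(K <= k < m) a0 k)).
    rewrite mulr_sumr; apply: ler_sum => k _.
    rewrite -innerBl (le_trans (cauchy_schwarz _ _))//.
    rewrite (@le_trans _ _ (M * `|xi k| * `|eta k|))// ?ler_wpM2r//.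
    by rewrite -mulrA ler_wpM2l.
  by rewrite ler_wpM2l// -(ger0_norm tl0) tl.
rewrite /=.
set a := rho T in m2 *; set b := rho (S n) in m1 *.
set a' := series _ m in m2 tail; set b' := series _ m in m1 tail.
have -> : a - b = (a - a') - (b' - a') - (b - b') by ring.
have -> : e = e / 4 + (e / 4 + e / 4) + e / 4 by field.
rewrite (le_trans (ler_normB _ _))// lerD ?(ltW m1)//.
rewrite (le_trans (ler_normB _ _))// lerD ?(ltW m2)//.
by rewrite (le_trans tail)// lerD2r ltW.
Unshelve. all: by end_near. Qed.

End SigmaWeak.

(** * Projections and Gram-Schmidt *)

Section Projections.
Context {R : realType} {H : hilbertType R}.
Implicit Types (p : boundedOp H) (x y u : H).

(** The value at 0 is 0, so a Gram-Schmidt step with a linearly dependent vector adds the zero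
    operator. *)
Definition normalize x : H := `|x|^-1 *: x.

Lemma norm_normalize x : x != 0 -> `|normalize x| = 1.
Proof. by move=> x0; rewrite normrZ normfV normr_id mulVf// normr_eq0. Qed.

Lemma inner_normalize x : inner x (normalize x) *: normalize x = x.
Proof.
have [->|x0] := eqVneq x 0; first by rewrite inner0l scale0r.
have nx : `|x| != 0 by rewrite normr_eq0.
rewrite innerZr inner_norm fmorphV /= (geC0_conj (normr_ge0 _)) scalerA.
by rewrite expr2 mulKf// divff// scale1r.
Qed.

Definition projection p := p * p = p /\ adjoint p = p.

Lemma projection_inner p x y : projection p -> inner (p x) y = inner x (p y).
Proof. by move=> [_ pa]; rewrite adjointP pa. Qed.

Lemma projectionK p x : projection p -> p (p x) = p x.
Proof. by move=> [pp _]; rewrite -bop_mulE pp. Qed.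

Lemma projection_contract p x : projection p -> `|p x| <= `|x|.
Proof.
move=> pp; have [->|px] := eqVneq (p x) 0; first by rewrite normr0.
have npx : 0 < `|p x| by rewrite normr_gt0.
rewrite -(ler_pM2l npx) -expr2 -[leLHS]ger0_norm ?exprn_ge0// -inner_norm.
rewrite (projection_inner _ _ pp) (projectionK _ pp).
by rewrite mulrC cauchy_schwarz.
Qed.

Lemma adjointD (S T : boundedOp H) : adjoint (S + T) = adjoint S + adjoint T.
Proof.
by apply: adjoint_unique => x y; rewrite !bop_addE innerDl innerDr !adjointP.
Qed.

Lemma projection_add_rank_one p x : projection p ->
  projection (p + rank_one (normalize (x - p x)) (normalize (x - p x))).
Proof.
move=> pp; set w := x - p x; set u := normalize w.
have pu : p u = 0 by rewrite bopZ bopB (projectionK _ pp) subrr scaler0.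
split; last by rewrite adjointD adjoint_rank_one pp.2.
apply: bop_ext => y; rewrite bop_mulE !bop_addE !bopD !rank_oneE (projectionK _ pp).
rewrite bopZ pu scaler0 addr0 (projection_inner _ _ pp) pu inner0r scale0r add0r.
rewrite innerZl -scalerA; congr (_ + _ *: _).
have [w0|w0] := eqVneq w 0; first by rewrite /u /normalize w0 scaler0 inner0l scale0r.
by rewrite inner_norm norm_normalize// expr1n scale1r.
Qed.

Section GramSchmidt.
Variable v : nat -> H.

(** The orthogonal projection onto the span of [v 0], ..., [v (n - 1)]. For a dense sequence these
    projections form a finite-rank approximate identity, to which normality will be applied. *)
Fixpoint gs_proj n : boundedOp H :=
  if n is n'.+1 then
    let p := gs_proj n' in
    p + rank_one (normalize (v n' - p (v n'))) (normalize (v n' - p (v n')))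
  else 0.

Lemma gs_projS n (w := v n - gs_proj n (v n)) :
  gs_proj n.+1 = gs_proj n + rank_one (normalize w) (normalize w).
Proof. by []. Qed.

Lemma gs_projP n : projection (gs_proj n).
Proof.
elim: n => [|n IH]; last exact: projection_add_rank_one.
split; first by rewrite mul0r.
by apply: adjoint_unique => x y; rewrite inner0l inner0r.
Qed.

Lemma gs_proj_fixS n x : gs_proj n x = x -> gs_proj n.+1 x = x.
Proof.
move=> nx; rewrite gs_projS bop_addE nx rank_oneE; set w := normalize _.
have -> : inner x w = inner (gs_proj n x) w by rewrite nx.
rewrite innerZr (projection_inner _ _ (gs_projP n)) bopB.
by rewrite (projectionK _ (gs_projP n)) subrr inner0r mulr0 scale0r addr0.
Qed.

Lemma gs_proj_fix n k : (k < n)%N -> gs_proj n (v k) = v k.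
Proof.
elim: n => // n IH; rewrite ltnS leq_eqVlt => /predU1P[->|kn]; last first.
  by apply: gs_proj_fixS; exact: IH.
rewrite gs_projS bop_addE rank_oneE; set p := gs_proj n; set w := v n - p (v n).
have pw : inner (p (v n)) (normalize w) = 0.
  rewrite (projection_inner _ _ (gs_projP n)) bopZ bopB.
  by rewrite (projectionK _ (gs_projP n)) subrr scaler0 inner0r.
have vn : v n = w + p (v n) by rewrite subrK.
rewrite {2}vn innerDl pw addr0 inner_normalize.
by rewrite addrC -vn.
Qed.

End GramSchmidt.

Lemma separable_dense_seq : separable H ->
  exists v : nat -> H, forall x (e : R[i]), 0 < e -> exists n, `|x - v n| < e.
Proof.
move=> [D [/countable_injP[f finj] Dd]].
(* Indices that code no point of [D] give 0; only density of the sequence matters. *)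
exists (fun n => xget 0 [set x | D x /\ f x = n]) => x e e0.
have Be0 : (interior (ball x e : set H)) !=set0.
  by exists x; apply: nbhsx_ballx.
have [y [/interior_subset Bey Dy]] := Dd _ Be0 (@open_interior H _).
have yE : [set x0 | D x0 /\ f x0 = f y] y by [].
have [Dg fg] := xgetI 0 yE; exists (f y).
by rewrite (finj _ _ _ _ fg) ?inE//; move: Bey; rewrite -ball_normE.
Qed.

(** Projections contract and fix [v k] once n > k, so the error at [x] is at most 2 |x - v k|. *)
Lemma gs_proj_cvg (v : nat -> H) :
  (forall x (e : R[i]), 0 < e -> exists n, `|x - v n| < e) ->
  forall x, gs_proj v n x @[n --> \oo] --> x.
Proof.
move=> vd x; apply/cvgrPdist_lt => e e0.
have [k kx] : exists n, `|x - v n| < e / 2 by apply: vd; rewrite divr_gt0.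
exists k.+1 => // n /= kn.
have -> : x - gs_proj v n x = (x - v k) - gs_proj v n (x - v k).
  by rewrite bopB gs_proj_fix// opprB addrA subrK.
rewrite (le_lt_trans (ler_normB _ _))// [e]splitr ltr_leD//.
exact: le_trans (projection_contract _ (gs_projP v n)) (ltW kx).
Qed.

End Projections.

(** * Existence of implementing isometries *)

Section Multiplicity.
Context {R : realType} {H : hilbertType R}.
Implicit Types (a b : boundedOp H -> boundedOp H) (x y u v : H) (T : boundedOp H).

Definition orthonormal_family (I : finType) (f : I -> H) :=
  forall i j, inner (f i) (f j) = (i == j)%:R.

Lemma orthonormal_family_norm (I : finType) (f : I -> H) i :
  orthonormal_family f -> `|f i| = 1.
Proof.
move=> fo; apply/eqP; rewrite -(@eqrXn2 _ 2)// -inner_norm fo eqxx expr1n.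
by [].
Qed.

(* The projections a |u><u| with |u| = 1 have rank at least #|I|. *)
Definition multiplicity a (I : finType) := exists u (f : I -> H),
  [/\ `|u| = 1, orthonormal_family f & forall i, a (rank_one u u) (f i) = f i].

Lemma multiplicity_inj a (I J : finType) (h : J -> I) :
  injective h -> multiplicity a I -> multiplicity a J.
Proof.
move=> hI [u [f [u1 fo af]]]; exists u, (f \o h); split=> // [i j|i /=]; last exact: af.
by rewrite /= fo (inj_eq hI).
Qed.

Section StarEndomorphism.
Variable a : boundedOp H -> boundedOp H.
Hypothesis a_star : star_endomorphism a.

Lemma star_endo0 : a 0 = 0.
Proof.
have [/(_ 1 0 0) + _ _] := a_star; rewrite !scale1r addr0 => a00.
by apply: (addrI (a 0)); rewrite -a00 addr0.
Qed.

Lemma star_endoD S T : a (S + T) = a S + a T.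
Proof. by have [/(_ 1 S T) + _ _] := a_star; rewrite !scale1r. Qed.

Lemma star_endoZ c T : a (c *: T) = c *: a T.
Proof. by have [/(_ c T 0) + _ _] := a_star; rewrite star_endo0 !addr0. Qed.

Lemma star_endoM S T : a (S * T) = a S * a T.
Proof. by have [_ /(_ S T) + _] := a_star. Qed.

Lemma star_endo_adjoint T : a (adjoint T) = adjoint (a T).
Proof. by have [_ _ /(_ T)] := a_star. Qed.

Lemma star_endo_rank_one_mul u v w x y :
  a (rank_one u v) (a (rank_one w x) y) = inner w v *: a (rank_one u x) y.
Proof. by rewrite -bop_mulE -star_endoM rank_one_mul star_endoZ. Qed.

Lemma inner_star_endo T x y : inner (a T x) y = inner x (a (adjoint T) y).
Proof. by rewrite adjointP star_endo_adjoint. Qed.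

Lemma star_endo_projection p : projection p -> projection (a p).
Proof. by move=> [pp pa]; split; rewrite -?star_endoM -?star_endo_adjoint ?pp ?pa. Qed.

Lemma rank_one_projection u : `|u| = 1 -> projection (rank_one u u).
Proof.
move=> u1; split; last exact: adjoint_rank_one.
by rewrite rank_one_mul inner_norm u1 expr1n scale1r.
Qed.

(** [a (rank_one v u)] is a partial isometry carrying the range of [a (rank_one u u)] onto that of
    [a (rank_one v v)]: the rank does not depend on the unit vector. *)
Lemma multiplicity_all (I : finType) v : multiplicity a I -> `|v| = 1 ->
  exists2 f : I -> H, orthonormal_family f &
    forall i, a (rank_one v v) (f i) = f i.
Proof.
move=> [u [f [u1 fo af]]] v1; exists (fun i => a (rank_one v u) (f i)).
  move=> i j; rewrite inner_star_endo adjoint_rank_one star_endo_rank_one_mul.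
  by rewrite inner_norm v1 expr1n scale1r af.
by move=> i; rewrite star_endo_rank_one_mul inner_norm v1 expr1n scale1r.
Qed.

(** The image of a minimal projection is a projection. A vector of its range orthogonal to [z] would
    complete an orthonormal pair. *)
Lemma star_endo_rank_one_cases u : ~ multiplicity a bool -> `|u| = 1 ->
  a (rank_one u u) = 0 \/ exists2 z, `|z| = 1 & a (rank_one u u) = rank_one z z.
Proof.
move=> am u1; set p := a _.
have pp : projection p by apply: star_endo_projection; exact: rank_one_projection.
have [[y py]|p0] := pselect (exists y, p y != 0); last first.
  left; apply: bop_ext => y; apply/eqP; apply: contra_notT p0 => py; by exists y.
right; set z := normalize (p y).
have z1 : `|z| = 1 by exact: norm_normalize.
have pz : p z = z by rewrite bopZ (projectionK _ pp).
exists z => //; apply: bop_ext => x; rewrite rank_oneE.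
pose w := p x - inner x z *: z.
suff w0 : w = 0 by apply/subr0_eq.
have pw : p w = w by rewrite bopB bopZ (projectionK _ pp) pz.
have wz : inner w z = 0.
  rewrite innerBl innerZl inner_norm z1 expr1n mulr1.
  by rewrite (projection_inner _ _ pp) pz subrr.
apply/eqP; apply: contra_notT am => w0.
exists u, (fun i : bool => if i then z else normalize w); split=> // [|[]//].
  move=> [] [] /=; rewrite ?inner_norm ?z1 ?norm_normalize ?expr1n//.
    by rewrite innerZr innerC wz rmorph0 mulr0.
  by rewrite innerZl wz mulr0.
by rewrite bopZ pw.
Qed.

End StarEndomorphism.

(** Multiplicities multiply: [b (rank_one u u)] dominates the mutually orthogonal projections
    [rank_one (f j) (f j)], and [a] turns each of them into a projection of rank at least #|I|. *)
Lemma multiplicity_comp a b (I J : finType) :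
  star_endomorphism a -> multiplicity a I -> multiplicity b J ->
  multiplicity (a \o b) (J * I)%type.
Proof.
move=> sa aI [u [f [u1 fo bf]]].
have /choice[g gP] : forall j, exists g : I -> H, orthonormal_family g /\
    forall i, a (rank_one (f j) (f j)) (g i) = g i.
  move=> j; have [g g1 g2] := multiplicity_all sa aI (orthonormal_family_norm j fo).
  by exists g.
exists u, (fun ji => g ji.1 ji.2); split=> // [[j i] [j' i'] /=|[j i] /=].
  rewrite xpair_eqE; have [<-|jj] /= := eqVneq j j'; first exact: (gP j).1.
  rewrite -(gP j).2 -(gP j').2 inner_star_endo// adjoint_rank_one.
  by rewrite star_endo_rank_one_mul// fo eq_sym (negbTE jj) scale0r inner0r.
rewrite -{1}(gP j).2 -bop_mulE -star_endoM// bop_mul_rank_one bf.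
exact: (gP j).2.
Qed.

Lemma multiplicity_rank_one u v (f : bool -> H) : `|v| = 1 ->
  orthonormal_family f -> (forall i, rank_one v v (f i) = f i) -> False.
Proof.
move=> v1 fo fv.
have := fo true false; rewrite -fv -(fv false) !rank_oneE innerZl innerZr.
rewrite inner_norm v1 expr1n mulr1 /= => /eqP; rewrite mulf_eq0 conjC_eq0.
move=> /orP[] /eqP f0.
  have := orthonormal_family_norm true fo.
  by rewrite -fv rank_oneE f0 scale0r normr0 => /esym/eqP; rewrite oner_eq0.
have := orthonormal_family_norm false fo.
by rewrite -fv rank_oneE f0 scale0r normr0 => /esym/eqP; rewrite oner_eq0.
Qed.

(** The image of the unit ball lies in the image of a compact square of coefficients under a
    continuous map. *)
Lemma compact_rank_one u v : compact_operator (rank_one u v).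
Proof.
rewrite /compact_operator.
pose f (p : R * R) : H := (p.1 +i* p.2)%C *: u.
pose r := complex.Re `|v|.
pose K : set (R * R) := `[- r, r]%classic `*` `[- r, r]%classic.
have fc : continuous f.
  move=> p; apply: cvgZl.
  have -> : (fun q : R * R => (q.1 +i* q.2)%C) =
      (fun q => (q.1)%:C%C + 'i%C * (q.2)%:C%C).
    by apply/funext => q; rewrite [LHS]complexE.
  have -> : (p.1 +i* p.2)%C = (p.1)%:C%C + 'i%C * (p.2)%:C%C by rewrite [LHS]complexE.
  apply: (@cvgD R[i] R[i]^o).
    by apply: cvg_real_complex; exact: cvg_fst.
  apply: (@cvgMl_tmp R[i]).
  by apply: cvg_real_complex; exact: cvg_snd.
have cK : compact (f @` K).
  apply: continuous_compact; first exact: continuous_subspaceT.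
  by apply: compact_setX; exact: segment_compact.
apply: (precompact_subset _ (B := f @` K)); last first.
  by rewrite precompact_closed//; apply: compact_closed => //; exact: norm_hausdorff.
move=> _ [x x1 <-]; rewrite rank_oneE.
exists (complex.Re (inner x v), complex.Im (inner x v)) => /=; last first.
  by rewrite /f /=; case: (inner x v).
have xv : `|inner x v| <= `|v|.
  by rewrite (le_trans (cauchy_schwarz _ _))// ler_piMl.
have rv : r%:C%C = `|v| by rewrite RReK ?normr_real.
split; rewrite /= in_itv /= -ler_norml -lecRE rv; apply: le_trans xv.
  exact: normc_ge_Re.
rewrite -normrN -ReiNIm (le_trans (normc_ge_Re _))// normrM.
by rewrite [`|'i%C|]normc_def /= expr0n expr1n add0r sqrtr1 mulr1.
Qed.

(** Distinct orthonormal vectors are at distance sqrt 2, so a ball of radius 1/2 contains at most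
    one of them. The size of a finite cover of the image of the unit ball by such balls is the
    bound. *)
Lemma compact_orthonormal_bound T : compact_operator T ->
  exists N : nat, forall (I : finType) (f : I -> H), orthonormal_family f ->
    (forall i, T (f i) = f i) -> (#|I| <= N)%N.
Proof.
rewrite /compact_operator precompactE compact_cover => Tc.
have [||D _ TD] := Tc H setT (fun z => interior (ball z (2^-1 : R[i]))).
- by move=> z _; exact: open_interior.
- move=> z _; exists z => //; apply: nbhsx_ballx.
  by rewrite invr_gt0.
exists (size (finmap.enum_fset D)) => I f fo Tf.
have /choice[c cP] : forall i, exists z : H,
    z \in finmap.enum_fset D /\ ball z (2^-1 : R[i]) (f i).
  move=> i; have [|z zD /interior_subset zf] := TD (f i).
    apply: subset_closure; exists (f i); rewrite ?Tf//.
    by rewrite /= (orthonormal_family_norm i fo).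
  by exists z.
rewrite cardE -(size_map c); apply: uniq_leq_size; last first.
  by move=> _ /mapP[i _ ->]; exact: (cP i).1.
rewrite map_inj_uniq ?enum_uniq// => i j cij.
have ci := (cP i).2; have := (cP j).2; rewrite -cij => cj.
apply/eqP; apply: contraT => ij.
have : `|f i - f j| < 1.
  have -> : f i - f j = (c i - f j) - (c i - f i).
    by rewrite opprB [RHS]addrC addrA subrK.
  move: ci cj; rewrite -ball_normE /= => ci cj.
  by rewrite (le_lt_trans (ler_normB _ _))// [1]splitr mul1r ltrD.
rewrite -(@ltr_pXn2r _ 2)// ?nnegrE// -inner_norm !(innerBl, innerBr) !fo !eqxx.
rewrite (negbTE ij) eq_sym (negbTE ij) expr1n subr0 sub0r opprK.
by rewrite gtrDl ltr10.
Qed.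

End Multiplicity.

Section Implementers.
Context {R : realType} {H : hilbertType R}.
Implicit Types (a b : boundedOp H -> boundedOp H) (x y u v : H) (T V W : boundedOp H).

Definition implements V a :=
  is_isometry V /\ forall T, a T = V * T * adjoint V.

Lemma implements_intertwine V a T : implements V a -> a T * V = V * T.
Proof. by move=> [iV ->]; rewrite -!mulrA isometry_adjointK// mulr1. Qed.

Lemma implements_rank_one V a x y :
  implements V a -> a (rank_one x y) = rank_one (V x) (V y).
Proof.
move=> [iV ->]; rewrite bop_mul_rank_one; apply: bop_ext => z.
by rewrite bop_mulE !rank_oneE -adjointPr.
Qed.

Lemma implementsM V W a b :
  implements V a -> implements W b -> implements (V * W) (a \o b).
Proof.
move=> [iV aV] [iW bW]; split; first exact: isometryM.
by move=> T; rewrite /= aV bW adjointM !mulrA.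
Qed.

Lemma implementsZ c V a : `|c| = 1 -> implements V a -> implements (c *: V) a.
Proof.
move=> c1 [iV aV]; split; first exact: isometryZ.
move=> T; rewrite aV adjointZ bop_scaleAr !bop_scaleAl scalerA.
by rewrite mulrC -normCK c1 expr1n scale1r.
Qed.

Lemma implements_id : implements 1 (@id (boundedOp H)).
Proof.
split=> // T; rewrite mul1r (_ : adjoint 1 = 1) ?mulr1//.
exact: adjoint_unique.
Qed.

(* Evaluate a |x><u| = |V x><V u| = |W x><W u| at V u. *)
Lemma implements_unique u V W a : `|u| = 1 -> implements V a -> implements W a ->
  `|inner (V u) (W u)| = 1 /\ V = inner (V u) (W u) *: W.
Proof.
move=> u1 Va Wa.
have uu : inner u u = 1 by rewrite inner_norm u1 expr1n.
have VW x : V x = inner (V u) (W u) *: W x.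
  have := congr1 (fun T : boundedOp H => T (V u)) (implements_rank_one x u Va).
  rewrite (implements_rank_one x u Wa) !rank_oneE.
  by rewrite ((isometry_inner V).1 Va.1) uu scale1r => <-.
split; last by apply: bop_ext => x; rewrite VW bop_scaleE.
have := congr1 Num.norm (VW u); rewrite normrZ Va.1 Wa.1 u1 mulr1.
exact: esym.
Qed.

(** The isometry is [V x = a (rank_one x u) z]. It satisfies [a T * V = V * T] by multiplicativity,
    so what remains is that [a 1] is exactly the range projection of [V]. *)
Lemma star_endo_implemented a u z : separable H ->
  star_endomorphism a -> normal_map a -> `|u| = 1 -> `|z| = 1 ->
  a (rank_one u u) = rank_one z z -> exists V, implements V a.
Proof.
move=> /separable_dense_seq[v vd] sa na u1 z1 auz.
have zz : rank_one z z z = z by rewrite rank_oneE inner_norm z1 expr1n scale1r.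
pose f x := a (rank_one x u) z.
have fi x y : inner (f x) (f y) = inner x y.
  rewrite /f inner_star_endo// adjoint_rank_one star_endo_rank_one_mul// auz zz.
  by rewrite innerZr inner_norm z1 expr1n mulr1 -innerC.
have [V VE] : exists V : boundedOp H, forall x, V x = f x.
  apply: (@mk_boundedOp _ _ f 1) => [c x y|x].
    rewrite /f -bop_scaleE -bop_addE -star_endoZ// -star_endoD//.
    congr (a _ _); apply: bop_ext => w.
    by rewrite bop_addE bop_scaleE !rank_oneE scalerDr !scalerA mulrC.
  rewrite mul1r -(@ler_pXn2r _ 2)// ?nnegrE//.
  by rewrite -!inner_norm fi.
have iV : is_isometry V by apply/isometry_inner => x y; rewrite !VE fi.
have aV T : a T * V = V * T.
  apply: bop_ext => x; rewrite !bop_mulE !VE /f -bop_mulE -star_endoM//.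
  by rewrite bop_mul_rank_one.
have uu : inner u u = 1 by rewrite inner_norm u1 expr1n.
have ar x y : a (rank_one x y) = V * rank_one x y * adjoint V.
  have -> : rank_one x y = rank_one x u * rank_one u u * rank_one u y.
    by rewrite !rank_one_mul uu !scale1r rank_one_mul uu scale1r.
  rewrite star_endoM// star_endoM// auz; apply: bop_ext => w.
  rewrite !bop_mulE rank_oneE.
  rewrite bopZ -[a _ z]/(f x) -VE rank_oneE bopZ; congr (_ *: _).
  rewrite inner_star_endo// adjoint_rank_one -[a _ z]/(f y) -VE adjointPr.
  by rewrite !rank_oneE !innerZl uu !mulr1.
have aproj n : a (gs_proj v n) = V * gs_proj v n * adjoint V.
  elim: n => [|n IH]; first by rewrite star_endo0// mulr0 mul0r.
  by rewrite gs_projS star_endoD// IH ar mulrDr mulrDl.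
(* This is where normality enters: the identity holds on the finite-rank projections [gs_proj v n],
   which tend to 1 sigma-weakly. *)
have a1 : a 1 = V * adjoint V.
  apply: bop_ext => x; apply: inner_injr => y.
  rewrite innerC [RHS]innerC; congr (_^*).
  have pv := predual_vector x y.
  have c1 := @normal_map_cvg R H a (gs_proj v @ \oo) _ 1 _ na pv.
  have {}c1 : (fun n => inner (a (gs_proj v n) x) y) @ \oo --> (inner (a 1 x) y : R[i]^o).
    apply: c1 => sigma sP; apply: (@predual_cvg R H sigma _ _ 2 sP) => // [n w|w].
      rewrite (le_trans (ler_normB _ _))// mulr_natl mulr2n lerD2r.
      exact: projection_contract (gs_projP v n).
    exact: gs_proj_cvg.
  apply: cvg_complex_unique c1 _.
  under eq_fun do rewrite aproj !bop_mulE adjointP.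
  rewrite bop_mulE adjointP; apply: cvg_inner; last exact: cvg_cst.
  exact: gs_proj_cvg.
exists V; split=> // T.
by rewrite -{1}[T]mulr1 star_endoM// a1 mulrA aV.
Qed.

End Implementers.

(** * From weak to strong convergence of endomorphisms *)

Section StrongConvergence.
Context {R : realType} {H : hilbertType R}.

Lemma cvg_norm_sqr {I : Type} {F : set_system I} {FF : Filter F} (f : I -> H) (l : H) :
  (fun i => `|l - f i| ^+ 2) @ F --> (0 : R[i]^o) -> f @ F --> l.
Proof.
move=> /(@cvgr0Pnorm_lt R[i] R[i]^o) f0; apply/cvgrPdist_lt => e e0.
have := f0 _ (exprn_gt0 2 e0); apply: filterS => i.
by rewrite normrX normr_id ltr_pXn2r ?nnegrE ?normr_ge0// ltW.
Qed.

(* |b T x - a_i T x|^2 only involves a_i (T^* T) and a_i T tested weakly. *)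
Lemma star_endo_cvg {I : Type} {F : set_system I} {FF : Filter F}
    (a : I -> boundedOp H -> boundedOp H) b (T : boundedOp H) (x : H) :
  (\forall i \near F, star_endomorphism (a i)) -> star_endomorphism b ->
  (forall S y z, (fun i => inner (a i S y) z) @ F --> (inner (b S y) z : R[i]^o)) ->
  (fun i => a i T x) @ F --> b T x.
Proof.
move=> sa sb ab; apply: cvg_norm_sqr.
have e : \forall i \near F, `|b T x - a i T x| ^+ 2 =
    (inner (b T x) (b T x) - (inner (a i T x) (b T x))^*) +
    (inner (a i (adjoint T * T) x) x - inner (a i T x) (b T x)).
  near=> i; have sai : star_endomorphism (a i) by near: i.
  rewrite (star_endoM sai) bop_mulE (star_endo_adjoint sai) -adjointPr.
  rewrite -inner_norm innerBl !innerBr -innerC.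
  by rewrite (innerC (a i T x) (a i T x)) -innerC opprB.
have c1 := ab T x (b T x).
have c2 := ab (adjoint T * T) x x.
have c0 : (fun=> inner (b T x) (b T x)) @ F --> (inner (b T x) (b T x) : R[i]^o).
  exact: (@cvg_cst R[i]^o).
have := @cvgD R[i] R[i]^o _ _ FF _ _ _ _
  (@cvgB R[i] R[i]^o _ _ FF _ _ _ _ c0 (cvg_complex_conj (FF := FF) c1))
  (@cvgB R[i] R[i]^o _ _ FF _ _ _ _ c2 c1).
rewrite (star_endoM sb) bop_mulE (star_endo_adjoint sb) -adjointPr -innerC.
rewrite !subrr addr0.
by apply: cvg_trans; apply: near_eq_cvg; move: e; apply: filterS => i ->.
Unshelve. all: by end_near. Qed.

End StrongConvergence.

Lemma cvg_at_rightI {R : realType} {I : Type} {F : set_system I} {FF : Filter F}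
    (f : I -> R) (l : R) :
  (\forall i \near F, l < f i) -> f @ F --> l -> f @ F --> l^'+.
Proof. by move=> lf fl A /fl; near_simpl; apply: filterS2 lf => i li; apply. Qed.

(** * Compactness forces multiplicity one *)

Section ESemigroup.
Context {R : realType} {d : nat} {H : hilbertType R}.
Variables (P : set 'cV[R]_d) (alpha : 'cV[R]_d -> boundedOp H -> boundedOp H).
Hypothesis P_cone : convex_cone P.
Hypothesis alphaE : E_semigroup P alpha.

Lemma cone0 : P 0.
Proof. by have [[x Px] /(_ 0 x (lexx 0) Px)] := P_cone; rewrite scale0r. Qed.

Lemma coneZ t x : 0 <= t -> P x -> P (t *: x).
Proof. by have [_ + _] := P_cone; apply. Qed.

Lemma coneD x y : P x -> P y -> P (x + y).
Proof.
move=> Px Py; have [_ _ /(_ 2^-1 (2 *: x) (2 *: y))] := P_cone.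
have h : (1 - 2^-1 : R) = 2^-1 by field.
rewrite h !scalerA mulVf// !scale1r; apply; rewrite ?invr_ge0 ?ler0n ?invf_le1 ?ler1n//.
- exact: coneZ.
- exact: coneZ.
Qed.

Lemma alpha_star x : P x -> star_endomorphism (alpha x).
Proof. exact: (E_semigroup_star alphaE). Qed.

Lemma alpha_weak_cvg x : P x -> forall T y z,
  (fun t => inner (alpha t T y) z) @ within P (nbhs x) --> (inner (alpha x T y) z : R[i]^o).
Proof.
move=> Px T y z.
have := @E_semigroup_continuous _ _ _ _ _ alphaE _ T (predual_vector y z).
by move=> /subspace_continuousP/(_ _ Px).
Qed.

Lemma alpha_strong_cvg x T y : P x ->
  (fun t => alpha t T y) @ within P (nbhs x) --> alpha x T y.
Proof.
move=> Px; apply: star_endo_cvg; [|exact: alpha_star|exact: alpha_weak_cvg].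
by apply: (@filterE _ (nbhs x)) => t Pt; exact: alpha_star Pt.
Qed.

Lemma ray_within x : P x -> (fun t : R => t *: x) @ 0^'+ --> within P (nbhs (0 : 'cV[R]_d)).
Proof.
move=> Px A A0; have := A0; rewrite /within /= => wA.
have c : (fun t : R => t *: x) @ 0^'+ --> (0 : 'cV[R]_d).
  rewrite -[X in _ --> X](scale0r x); apply: cvg_at_right_filter.
  exact: (@cvgZl _ _ _ _ _ (fun t : R => t)).
have := c _ wA; near_simpl => cA.
near=> t; have : P (t *: x) -> A (t *: x) by near: t.
by apply; apply: coneZ => //; near: t; exact: nbhs_right_ge.
Unshelve. all: by end_near. Qed.

Lemma alpha_rays_cvg x : P x -> forall T y z,
  (fun t : R => inner (alpha (t *: x) T y) z) @ 0^'+ --> (inner (T y) z : R[i]^o).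
Proof.
move=> Px T y z; have := @alpha_weak_cvg 0 cone0 T y z.
rewrite (E_semigroup0 alphaE) => c0; exact: cvg_comp (ray_within Px) c0.
Qed.

Lemma alphaD x y : P x -> P y -> alpha (x + y) = alpha x \o alpha y.
Proof. by move=> Px Py; rewrite (E_semigroupD alphaE). Qed.

Lemma alpha_half x : P x -> P (2^-1 *: x) /\ alpha x = alpha (2^-1 *: x) \o alpha (2^-1 *: x).
Proof.
move=> Px; have Px2 : P (2^-1 *: x) by apply: coneZ => //; rewrite invr_ge0.
split=> //; rewrite -alphaD// -scalerDl; congr (alpha _).
by rewrite (_ : _ + _ = 1) ?scale1r//; field.
Qed.

Section Compact.
Hypothesis alpha_compact : forall x, P x -> forall T : boundedOp H,
  compact_operator T -> compact_operator (alpha x T).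

(** A type with 2^n elements, in the product shape that [multiplicity_comp] produces. *)
Fixpoint cube n : finType := if n is n'.+1 then (cube n' * bool)%type else unit.

Lemma card_cube n : #|cube n| = (2 ^ n)%N.
Proof. by elim: n => [|n IH]; rewrite ?card_unit//= card_prod card_bool IH expnSr. Qed.

(* Each alpha x is a square, so a multiplicity > 1 is at least 2^n for all n. *)
Lemma multiplicity_cube n x : P x -> multiplicity (alpha x) bool ->
  multiplicity (alpha x) (cube n).
Proof.
elim: n x => [|n IH] x Px mx.
  by apply: (multiplicity_inj (h := fun=> true) _ mx) => -[] [].
have [Px2 ax] := alpha_half Px.
(* If [alpha (2^-1 *: x)] sent minimal projections to projections of rank at most one, so would its
   square [alpha x]. *)
have mx2 : multiplicity (alpha (2^-1 *: x)) bool.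
  apply: contrapT => nm; have [u [f [u1 fo]]] := mx; rewrite ax /=.
  have [->|[z z1 ->]] := star_endo_rank_one_cases (alpha_star Px2) nm u1.
    rewrite (star_endo0 (alpha_star Px2)) => /(_ true) f0.
    have := orthonormal_family_norm true fo.
    by rewrite -f0 normr0 => /esym/eqP; rewrite oner_eq0.
  have [->|[w w1 ->]] := star_endo_rank_one_cases (alpha_star Px2) nm z1.
    move=> /(_ true) f0; have := orthonormal_family_norm true fo.
    by rewrite -f0 normr0 => /esym/eqP; rewrite oner_eq0.
  exact: multiplicity_rank_one.
rewrite ax; apply: multiplicity_comp (alpha_star Px2) mx2 (IH _ Px2 mx2).
Qed.

Lemma alpha_not_multiplicity x : P x -> ~ multiplicity (alpha x) bool.
Proof.
move=> Px mx; have [u [f [u1 _ _]]] := mx.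
have [N Nb] := compact_orthonormal_bound (alpha_compact Px (compact_rank_one u u)).
have [g go gf] := multiplicity_all (alpha_star Px) (multiplicity_cube N Px mx) u1.
have := Nb _ g go gf; rewrite card_cube leqNgt.
by rewrite ltn_expl.
Qed.

(** By weak continuity at 0, [alpha (x / 2^n)] does not kill |u><u| for some n, and multiplicity at
    least one passes from an endomorphism to its square. *)
Lemma alpha_nonzero x (u : H) : P x -> `|u| = 1 -> multiplicity (alpha x) unit.
Proof.
move=> Px u1.
have half n : multiplicity (alpha (2^-1 ^+ n *: x)) unit -> multiplicity (alpha x) unit.
  elim: n => [|n IH]; first by rewrite expr0 scale1r.
  rewrite exprS -scalerA => m2; apply: IH.
  have Pn : P (2^-1 ^+ n *: x) by apply: coneZ => //; rewrite exprn_ge0 ?invr_ge0.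
  have [Pn2 ->] := alpha_half Pn.
  apply: (multiplicity_inj (h := fun=> (tt, tt))); first by move=> [] [].
  exact: (multiplicity_comp (alpha_star Pn2) m2 m2).
have c := @alpha_rays_cvg x Px (rank_one u u) u u.
have uu : inner u u = 1 by rewrite inner_norm u1 expr1n.
have c1 : inner (rank_one u u u) u = 1 by rewrite rank_oneE innerZl uu mulr1.
rewrite c1 in c.
have [n n0] : exists n, alpha (2^-1 ^+ n *: x) (rank_one u u) != 0.
  have h : (fun n : nat => (2^-1 : R) ^+ n) @ \oo --> 0^'+.
    apply: cvg_at_rightI; first by apply: nearW => n; rewrite exprn_gt0.
    by apply: cvg_expr; rewrite gtr0_norm// invf_lt1// ltr1n.
  have := cvg_comp _ _ h c => /(@cvgrPdist_lt R[i] R[i]^o)/(_ 1 ltr01).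
  move=> [n _ /(_ n (leqnn n)) /= n1]; exists n.
  by apply: contraTneq n1 => ->; rewrite inner0l subr0 normr1 ltxx.
apply: (half n).
have Pn : P (2^-1 ^+ n *: x) by apply: coneZ => //; rewrite exprn_ge0 ?invr_ge0.
have [/eqP|[z z1 az]] :=
  star_endo_rank_one_cases (alpha_star Pn) (alpha_not_multiplicity Pn) u1.
  by rewrite (negbTE n0).
exists u, (fun=> z); split=> // [[] []|_]; first by rewrite inner_norm z1 expr1n.
by rewrite az rank_oneE inner_norm z1 expr1n scale1r.
Qed.

Lemma alpha_implemented x (u : H) : separable H -> P x -> `|u| = 1 ->
  exists V, implements V (alpha x).
Proof.
move=> sepH Px u1.
have [f fo fa] := multiplicity_all (alpha_star Px) (alpha_nonzero Px u1) u1.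
have [a0|[z z1 az]] := star_endo_rank_one_cases (alpha_star Px) (alpha_not_multiplicity Px) u1.
  have := orthonormal_family_norm tt fo.
  by rewrite -fa a0 normr0 => /esym/eqP; rewrite oner_eq0.
apply: star_endo_implemented az => //; first exact: alpha_star.
exact: (E_semigroup_normal alphaE).
Qed.

End Compact.

End ESemigroup.

(** * Characters and bounded cocycles on the half-line *)

Section Circle.
Context {R : realType}.
Implicit Types (x y s t : R) (z w : R[i]).

Lemma expiE t : expi t = (cos t)%:C%C + 'i%C * (sin t)%:C%C.
Proof. by rewrite [LHS]complexE. Qed.

Lemma expi0 : expi 0 = 1 :> R[i].
Proof. by rewrite /expi cos0 sin0. Qed.

Lemma expiD s t : expi (s + t) = expi s * expi t.
Proof.
rewrite /expi cosD sinD; apply/eqP; rewrite eq_complex /=.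
by rewrite eqxx addrC eqxx.
Qed.

Lemma norm_expi t : `|expi t| = 1.
Proof. by rewrite normc_def /= cos2Dsin2 sqrtr1. Qed.

Lemma expiNK t : expi (- t) * expi t = 1.
Proof. by rewrite -expiD addNr expi0. Qed.

Lemma expi_neq0 t : expi t != 0.
Proof. by rewrite -normr_eq0 norm_expi oner_eq0. Qed.

Lemma cvg_expi {I : Type} {F : set_system I} {FF : Filter F} (f : I -> R) (l : R) :
  f @ F --> l -> (fun i => expi (f i)) @ F --> (expi l : R[i]^o).
Proof.
move=> fl; rewrite expiE; under eq_fun do rewrite expiE.
have c : (fun i => (cos (f i))%:C%C) @ F --> ((cos l)%:C%C : R[i]^o).
  by apply: cvg_real_complex; apply: cvg_comp fl _; exact: continuous_cos.
have s : (fun i => (sin (f i))%:C%C) @ F --> ((sin l)%:C%C : R[i]^o).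
  by apply: cvg_real_complex; apply: cvg_comp fl _; exact: continuous_sin.
have ci : (fun i => 'i%C * (sin (f i))%:C%C) @ F --> ('i%C * (sin l)%:C%C : R[i]^o).
  by apply: (@cvgMl_tmp R[i]).
exact: (@cvgD R[i] R[i]^o _ _ FF _ _ _ _ c ci).
Qed.

Lemma expi_eq1 x : `|x| <= 1 -> expi x = 1 -> x = 0.
Proof.
move=> x1 [c1 _]; have p1 : 1 <= pi :> R by rewrite (@le_trans _ _ 2) ?pi_ge2// ler1n.
have ax : `|x| \in `[0, pi]%R by rewrite in_itv /= normr_ge0 (le_trans x1).
have a0 : (0 : R) \in `[0, pi]%R by rewrite in_itv /= lexx pi_ge0.
apply/eqP; rewrite -normr_eq0; apply/eqP; apply: cos_inj => //.
by rewrite cos0 -c1; have [_|_] := ger0P x; rewrite ?cosN.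
Qed.

Lemma expi_lin_eq1 x : (forall t, 0 <= t -> expi (x * t) = 1) -> x = 0.
Proof.
move=> h; have y1 : 0 < `|x| + 1 by rewrite ltr_wpDl.
have := h (`|x| + 1)^-1; rewrite invr_ge0 ltW// => /(_ isT)/expi_eq1.
rewrite normrM normfV (gtr0_norm y1) ler_pdivrMr// mul1r lerDl ler01.
move=> /(_ isT)/eqP; rewrite mulf_eq0 invr_eq0 (gt_eqF y1) orbF.
by move=> /eqP.
Qed.

(** An argument only on the open right half of the unit circle, the domain of [expi_arg]. *)
Definition arg z : R := asin (complex.Im z).

Lemma circle_Re_Im z : `|z| = 1 -> complex.Re z ^+ 2 + complex.Im z ^+ 2 = 1.
Proof.
move=> z1; have := add_Re2_Im2 z; rewrite z1 expr1n.
by move=> [].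
Qed.

Lemma expi_arg z : `|z| = 1 -> 0 < complex.Re z -> expi (arg z) = z.
Proof.
move=> z1 rz; have zz := circle_Re_Im z1.
have im : -1 <= complex.Im z <= 1.
  rewrite -ler_norml -(@ler_pXn2r _ 2)// ?nnegrE// real_normK ?num_real// expr1n.
  by rewrite -zz lerDr sqr_ge0.
rewrite /expi /arg cos_asin// asinK ?in_itv//.
have -> : 1 - complex.Im z ^+ 2 = complex.Re z ^+ 2 by rewrite -zz addrK.
by rewrite sqrtr_sqr gtr0_norm//; case: (z).
Qed.

Lemma arg1 : arg 1 = 0.
Proof.
have -> : arg 1 = asin (sin 0) by rewrite sin0.
by rewrite sinK// in_itv/= oppr_le0 divr_ge0// pi_ge0.
Qed.

Lemma cvg_arg {I : Type} {F : set_system I} {FF : Filter F} (f : I -> R[i]) :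
  f @ F --> (1 : R[i]^o) -> (fun i => arg (f i)) @ F --> (0 : R).
Proof.
move=> f1; rewrite -arg1.
apply: (@cvg_comp _ _ _ (fun i => complex.Im (f i)) (@asin R)); last first.
  by apply: continuous_asin; rewrite /= oppr_lt0 ltr01.
have -> : (fun i => complex.Im (f i)) = (fun i => - complex.Re (f i * 'i%C)).
  by apply/funext => i; rewrite ReiNIm opprK.
rewrite -[complex.Im 1]opprK -ReiNIm; apply: cvgN; apply: cvg_complexRe.
exact: (@cvgMr_tmp R[i]).
Qed.

(** The recursion is that of cos(2^n x). The deficit satisfies 1 - c_{n+1} = 2 (1 - c_n) (1 + c_n),
    so it grows unless it is 0, while positivity keeps it below 1. Linear growth already gives the
    contradiction. *)
Lemma doubling_eq1 (c : nat -> R) : (forall n, c n.+1 = 2 * c n ^+ 2 - 1) ->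
  (forall n, 0 < c n) -> c 0%N <= 1 -> c 0%N = 1.
Proof.
move=> cS c0 c1; apply/eqP; rewrite eq_le c1 /=.
have cle n : c n <= 1.
  elim: n => // n IH; rewrite cS; have := c0 n; nra.
have grow n : n%:R * (1 - c 0%N) <= 1 - c n.
  elim: n => [|n IH]; first by rewrite mul0r subr_ge0.
  rewrite -natr1 cS; have := c0 n; have := cle n.
  have [->|n0] := posnP n; first by nra.
  have : 1 <= n%:R :> R by rewrite ler1n.
  nra.
rewrite leNgt; apply/negP => lt1; have e0 : 0 < 1 - c 0%N by rewrite subr_gt0.
have := grow (Num.truncn (1 - c 0%N)^-1).+1; apply/negP; rewrite -ltNge.
rewrite (@lt_le_trans _ _ 1)//; first by rewrite gtrBl.
rewrite -ler_pdivrMr// mul1r ltW//; exact: truncnS_gt.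
Qed.

(** A form of the absence of small subgroups in the circle. The real parts of successive squares
    obey the doubling formula of the cosine. *)
Lemma circle_eq1 z : `|z| = 1 -> (forall n, 0 < complex.Re (z ^+ (2 ^ n))) -> z = 1.
Proof.
move=> z1 zn.
have nz n : `|z ^+ n| = 1 by rewrite normrX z1 expr1n.
have re2 w : `|w| = 1 -> complex.Re (w ^+ 2) = 2 * complex.Re w ^+ 2 - 1.
  by move=> /circle_Re_Im; rewrite [w ^+ 2]expr2; case: w => a b /=; lra.
have := @doubling_eq1 (fun n => complex.Re (z ^+ (2 ^ n))).
rewrite expn0 expr1 => h.
have rz : complex.Re z = 1.
  apply: h => [n|//|]; first by rewrite expnSr exprM re2.
  by rewrite (le_trans (Re_le_norm _))// z1.
have := circle_Re_Im z1; rewrite rz expr1n => /eqP; rewrite -subr_eq0 addrAC subrr add0r.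
rewrite expf_eq0 /= => /eqP iz; rewrite [z]complexE rz iz.
by rewrite mulr0 addr0.
Qed.

End Circle.

Section Characters.
Context {R : realType}.
Implicit Types (x y s t : R) (chi : R -> R[i]).

Lemma real_euclid (e t : R) : 0 < e -> 0 <= t ->
  exists (n : nat) (r : R), [/\ t = n%:R * e + r, 0 <= r & r < e].
Proof.
move=> e0 t0; exists (Num.truncn (t / e)), (t - (Num.truncn (t / e))%:R * e).
have te : 0 <= t / e by rewrite divr_ge0// ltW.
have /andP[h1 h2] := truncn_itv te; split; first by rewrite addrC subrK.
  by rewrite subr_ge0 -ler_pdivlMr.
by rewrite ltrBlDl -[X in _ < _ + X]mul1r -mulrDl addrC nat1r -ltr_pdivrMr.
Qed.

Lemma euclid_carry (e q p : R) (k m : nat) : 0 < e -> 0 <= q -> q < e ->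
  0 <= p -> p < 2 * e -> k%:R * e + q = m%:R * e + p -> k = m \/ k = m.+1.
Proof.
move=> e0 q0 qe p0 pe eqn.
have le_me (i j : nat) : (i < j)%N -> i%:R * e + e <= j%:R * e.
  move=> ij; rewrite -[X in _ + X]mul1r -mulrDl ler_wpM2r ?(ltW e0)//.
  by rewrite natr1 ler_nat.
have [/le_me h1|h1|->] := ltngtP k m; [by exfalso; lra| |by left].
have [h2|/le_me h2|->] := ltngtP k m.+1; last by right.
  by rewrite ltnS leqNgt h1 in h2.
by move: h2; rewrite -natr1 mulrDl mul1r => h2; exfalso; lra.
Qed.

Definition character chi :=
  [/\ forall t, 0 <= t -> `|chi t| = 1,
      forall s t, 0 <= s -> 0 <= t -> chi (s + t) = chi s * chi t &
      chi @ 0^'+ --> (1 : R[i]^o)].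

Lemma cos_gt0_lt1 x : `|x| < 1 -> 0 < cos x.
Proof.
rewrite ltr_norml => /andP[x1 x2].
have p2 : 1 <= pi / 2 :> R by rewrite ler_pdivlMr// mul1r pi_ge2.
apply: cos_gt0_pihalf; rewrite (lt_le_trans x2)// andbT.
by rewrite (le_lt_trans _ x1)// lerN2.
Qed.

Lemma cvg_complexRe_gt0 {I : Type} {F : set_system I} {FF : Filter F} (f : I -> R[i]) :
  f @ F --> (1 : R[i]^o) -> \forall i \near F, 0 < complex.Re (f i).
Proof.
move=> /cvg_complexRe f1; apply: (@cvgr_gt _ _ _ _ _ _ f1).
exact: ltr01.
Qed.

Lemma character0 chi : character chi -> chi 0 = 1.
Proof.
move=> [chi1 chiD _]; have c0 : chi 0 != 0 by rewrite -normr_eq0 chi1// oner_eq0.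
by apply: (mulfI c0); rewrite -chiD// addr0 mulr1.
Qed.

Lemma character_natM chi n s : character chi -> 0 <= s ->
  chi (n%:R * s) = chi s ^+ n.
Proof.
move=> cc s0; have [_ chiD _] := cc; elim: n => [|n IH].
  by rewrite mul0r expr0 character0.
by rewrite -natr1 mulrDl mul1r chiD ?mulr_ge0// IH exprSr.
Qed.

Lemma expi_natM n x : expi x ^+ n = expi (n%:R * x).
Proof.
elim: n => [|n IH]; first by rewrite mul0r expr0 expi0.
by rewrite exprSr IH -natr1 mulrDl mul1r expiD.
Qed.

(** On a short interval [0, e] the argument of [chi] is below 1/2. Dividing by the exponential that
    agrees with [chi] at [e] gives an e-periodic character [psi]; its argument on one period is a
    difference of two such terms, hence below 1, so its real part is positive everywhere and
    [circle_eq1] applies. *)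
Lemma characterP chi : character chi -> exists k, forall t, 0 <= t -> chi t = expi (k * t).
Proof.
move=> cc; have [chi1 chiD chic] := cc.
have chi0 := character0 cc.
have [e e0 small] : exists2 e, 0 < e & forall t, 0 <= t -> t <= e ->
    `|arg (chi t)| < 2^-1 /\ 0 < complex.Re (chi t).
  have h1 := cvg_complexRe_gt0 chic.
  have h2 : \forall t \near 0^'+, `|arg (chi t)| < 2^-1.
    apply: (@cvgr0_norm_lt R R _ _ _ _ (cvg_arg chic)).
    by rewrite invr_gt0.
  have [e /= e0 he] : \forall t \near 0^'+, `|arg (chi t)| < 2^-1 /\ 0 < complex.Re (chi t).
    by near=> t; split; near: t; [exact: h2|exact: h1].
  exists (e / 2) => [|t]; first by rewrite divr_gt0.
  rewrite le_eqVlt => /predU1P[<- _|t0 te].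
    by rewrite chi0 arg1 normr0 invr_gt0 ltr0n ltr01.
  apply: he => //=; rewrite sub0r normrN gtr0_norm//.
  by rewrite (le_lt_trans te)// ltr_pdivrMr// ltr_pMr// ltr1n.
pose k := arg (chi e) / e; exists k => t t0.
pose psi s := chi s * expi (- (k * s)).
have psiE s : 0 <= s -> chi s = psi s * expi (k * s).
  by move=> s0; rewrite /psi -mulrA expiNK mulr1.
suff psi1 : psi t = 1 by rewrite psiE// psi1 mul1r.
have psiD s u : 0 <= s -> 0 <= u -> psi (s + u) = psi s * psi u.
  by move=> s0 u0; rewrite /psi chiD// mulrDr opprD expiD mulrACA.
have psin n s : 0 <= s -> psi (n%:R * s) = psi s ^+ n.
  move=> s0; elim: n => [|n IH].
    by rewrite mul0r expr0 /psi chi0 mulr0 oppr0 expi0 mulr1.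
  by rewrite -natr1 mulrDl mul1r psiD ?mulr_ge0// IH exprSr.
have psie : psi e = 1.
  have [_ re] := small e (ltW e0) (lexx e).
  rewrite /psi -{1}(expi_arg (chi1 e (ltW e0)) re) /k divfK ?gt_eqF//.
  by rewrite mulrC expiNK.
have psi_Re s : 0 <= s -> 0 < complex.Re (psi s).
  move=> s0; have [n [r [-> r0 re]]] := real_euclid e0 s0.
  rewrite (psiD _ _ (mulr_ge0 (ler0n _ n) (ltW e0)) r0) (psin _ _ (ltW e0)).
  rewrite psie expr1n mul1r.
  have [a1 rr] := small r r0 (ltW re); have [a2 _] := small e (ltW e0) (lexx e).
  rewrite /psi -(expi_arg (chi1 r r0) rr) -expiD /=; apply: cos_gt0_lt1.
  rewrite (le_lt_trans (ler_normB _ _))// [1]splitr !mul1r ltrD//.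
  apply: le_lt_trans a2; rewrite /k mulrAC -mulrA normrM ler_piMr//.
  by rewrite ger0_norm ?divr_ge0 ?(ltW e0)// ler_pdivrMr// mul1r ltW.
apply: circle_eq1 => [|n]; first by rewrite /psi normrM chi1// norm_expi mulr1.
by rewrite -psin//; apply: psi_Re; rewrite mulr_ge0.
Unshelve. all: by end_near. Qed.

(** Each variable separately gives exponents [l s] and [m t]. Comparing them at s = 1/n shows that
    [nu / n] lies in 2 pi Z for every n >= 1, which forces [nu = 0], so [m] is linear although it
    was chosen pointwise. *)
Lemma bicharacterP (chi : R -> R -> R[i]) :
  (forall s, 0 <= s -> character (chi s)) ->
  (forall t, 0 <= t -> character (chi^~ t)) ->
  exists k, forall s t, 0 <= s -> 0 <= t -> chi s t = expi (k * s * t).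
Proof.
move=> c1 c2.
have /choice[l lE] : forall s, exists l, 0 <= s -> forall t, 0 <= t -> chi s t = expi (l * t).
  move=> s; have [s0|_] := leP 0 s; last by exists 0.
  by have [k kE] := characterP (c1 s s0); exists k => _.
have /choice[m mE] : forall t, exists m, 0 <= t -> forall s, 0 <= s -> chi s t = expi (m * s).
  move=> t; have [t0|_] := leP 0 t; last by exists 0.
  by have [k kE] := characterP (c2 t t0); exists k => _.
exists (l 1) => s t s0 t0; rewrite (mE t t0 s s0).
suff -> : m t = l 1 * t by rewrite mulrAC.
apply/eqP; rewrite -subr_eq0; apply/eqP; set nu := m t - l 1 * t.
have n0 (n : nat) : expi (nu / n.+1%:R) = 1.
  have n1 : 0 <= n.+1%:R^-1 :> R by rewrite invr_ge0.
  have nn0 : n.+1%:R != 0 :> R by rewrite pnatr_eq0.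
  have lin : l n.+1%:R^-1 = l 1 / n.+1%:R.
    apply/eqP; rewrite -[_ == _](inj_eq (mulfI nn0)) -subr_eq0.
    apply/eqP/expi_lin_eq1 => u u0; rewrite mulrBl expiD [n.+1%:R * (_ / _)]mulrC.
    rewrite divfK// -mulrA -expi_natM -lE// -(character_natM _ (c2 u u0))//.
    by rewrite mulfV// (lE _ ler01 _ u0) mulrC expiNK.
  have := mE t t0 _ n1; rewrite (lE _ n1 _ t0) lin => h.
  by rewrite /nu mulrBl expiD -h mulrAC mulrC expiNK.
apply/eqP; have y0 := n0 (Num.truncn `|nu|); apply: contraTT isT => nu0.
have : nu / (Num.truncn `|nu|).+1%:R = 0.
  apply: expi_eq1 y0; rewrite normrM normfV normr_nat.
  by rewrite ler_pdivrMr// mul1r ltW// truncnS_gt.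
by move=> /eqP; rewrite mulf_eq0 invr_eq0 (negbTE nu0) pnatr_eq0.
Qed.

Lemma arg_small (e : R) : 0 < e -> exists2 r : R, 0 < r &
  forall z : R[i], `|z - 1| < r%:C%C -> `|arg z| < e /\ 0 < complex.Re z.
Proof.
move=> e0.
have id1 : (fun z : R[i] => z) @ nbhs (1 : R[i]^o) --> (1 : R[i]^o) by [].
have F1 : Filter (nbhs (1 : R[i]^o)) by typeclasses eauto.
have a0 := cvg_arg (FF := F1) id1.
have r0 := cvg_complexRe_gt0 (FF := F1) id1.
have : \forall z \near (1 : R[i]^o), `|arg z| < e /\ 0 < complex.Re z.
  move: a0 => /cvgr0Pnorm_lt/(_ _ e0) a0.
  by near=> z; split; near: z; [exact: a0|exact: r0].
move=> [_ /= /real_complex_eps[r rp ->] h]; exists r => // z z1.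
by apply: h; rewrite /ball_ /= distrC.
Unshelve. all: by end_near. Qed.

Lemma cvg_double_right : (fun t : R => 2 * t) @ 0^'+ --> 0^'+.
Proof.
apply: cvg_at_rightI.
  by near=> t; rewrite mulr_gt0//; near: t; exact: nbhs_right_gt.
rewrite -[X in _ --> X](mulr0 2); apply: cvgMl_tmp.
exact: cvg_at_right_filter.
Unshelve. all: by end_near. Qed.

(* g t = - \sum_n sigma (2^n t) / 2^(n+1), as in Hyers' stability theorem. *)
Lemma hyers_series (sigma : R -> R) (e : R) :
  (forall t, 0 <= t -> `|sigma t| <= e) -> sigma @ 0^'+ --> (0 : R) ->
  exists g : R -> R, [/\ forall t, 0 <= t -> `|g t| <= e,
    forall t, 0 <= t -> g (2 * t) = 2 * g t + sigma t & g @ 0^'+ --> (0 : R)].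
Proof.
move=> se s0.
pose u t n := sigma (2 ^+ n * t) / 2 ^+ n.+1.
pose G t n : R := series (u t) n.
have p2 n : 0 < 2 ^+ n :> R by rewrite exprn_gt0.
have ule t n : 0 <= t -> `|u t n| <= geometric (e / 2) 2^-1 n.
  move=> t0; rewrite /u /geometric /= normrM normfV (gtr0_norm (p2 _)).
  have -> : e / 2 * 2^-1 ^+ n = e / 2 ^+ n.+1 by rewrite exprVn exprS invfM mulrA.
  by rewrite ler_pM2r ?invr_gt0// se// mulr_ge0// ltW.
have cG t : 0 <= t -> cvgn (G t).
  move=> t0; apply: normed_cvg; apply: series_le_cvg => [n|n|n|].
  - exact: normr_ge0.
  - exact: le_trans (normr_ge0 _) (ule t n t0).
  - exact: ule.
  by apply: is_cvg_geometric_series; rewrite gtr0_norm ?invr_gt0// invf_lt1// ltr1n.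
have G2 t n : G (2 * t) n = 2 * G t n.+1 - sigma t.
  rewrite /G /series /= big_nat_recl//= mulrDr [u t 0%N]/u expr0 mul1r expr1.
  rewrite mulrCA mulfV// mulr1 addrC addKr mulr_sumr.
  apply: eq_bigr => i _; rewrite /u mulrA -exprSr [2 ^+ i.+2]exprS.
  by have := gt_eqF (p2 i.+1); set w := 2 ^+ i.+1 => w0; field; rewrite w0.
exists (fun t => - limn (G t)).
have g2 t : 0 <= t -> - limn (G (2 * t)) = 2 * - limn (G t) + sigma t.
  move=> t0; have c1 : G (2 * t) @ \oo --> 2 * limn (G t) - sigma t.
    have -> : G (2 * t) = (fun n => 2 * G t n.+1 - sigma t) by apply/funext.
    apply: cvgB; last exact: cvg_cst.
    apply: cvgMl_tmp; rewrite (cvg_shiftS (G t)); exact: cG.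
  by rewrite (cvg_lim _ c1)// opprB mulrN addrC.
have e0 : 0 <= e by exact: le_trans (se 0 (lexx 0)).
have Gle t n : 0 <= t -> `|G t n| <= e.
  move=> t0; have : `|G t n| <= e * (1 - 2^-1 ^+ n).
    elim: n => [|n IH].
      by rewrite /G /series /= big_nil normr0 expr0 subrr mulr0.
    rewrite /G /series /= big_nat_recr//= (le_trans (ler_normD _ _))//.
    apply: (le_trans (lerD IH (ule t n t0))); rewrite /geometric /= exprS.
    lra.
  move=> /le_trans; apply; rewrite ler_piMr// gerBl exprn_ge0//.
have ge t : 0 <= t -> `|- limn (G t)| <= e.
  move=> t0; rewrite normrN -(cvg_lim _ (cvg_norm (cG t t0)))//.
  apply: limr_le; first exact: is_cvg_norm (cG t t0).
  by near=> n; exact: Gle.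
split => //.
(* The relation g(2t) = 2 g(t) + sigma(t) halves a bound valid near 0, up to an error controlled by
   [sigma]; iterating it removes the initial bound [e]. *)
have near_small f : 0 < f -> forall n, \forall t \near 0^'+,
    `|- limn (G t)| <= e / 2 ^+ n + f.
  move=> f0; elim=> [|n IH].
    near=> t; have t0 : 0 <= t by near: t; exact: nbhs_right_ge.
    by rewrite expr0 divr1 (le_trans (ge t t0))// lerDl ltW.
  have h1 : \forall t \near 0^'+, `|- limn (G (2 * t))| <= e / 2 ^+ n + f :=
    cvg_double_right IH.
  have h2 : \forall t \near 0^'+, `|sigma t| <= f.
    by move/cvgr0Pnorm_le : s0; apply.
  near=> t.
  have t0 : 0 <= t by near: t; exact: nbhs_right_ge.
  have : `|- limn (G (2 * t))| <= e / 2 ^+ n + f by near: t; exact: h1.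
  have : `|sigma t| <= f by near: t; exact: h2.
  rewrite g2// exprS invfM mulrCA.
  set a := - limn _; set b := sigma t; set c := e / 2 ^+ n => bf.
  have := ler_normB (2 * a + b) b; rewrite addrK normrM normr_nat; lra.
apply/cvgr0Pnorm_le => f f0.
have f2 : 0 < f / 2 by rewrite divr_gt0.
have [n ne] : exists n, e / 2 ^+ n <= f / 2.
  exists (Num.truncn (e / (f / 2))).+1; rewrite ler_pdivrMr// mulrC -ler_pdivrMr//.
  apply/ltW/(lt_trans (truncnS_gt _)).
  by rewrite -natrX ltr_nat ltn_expl.
near=> t; have : `|- limn (G t)| <= e / 2 ^+ n + f / 2.
  by near: t; exact: near_small.
by move=> /le_trans; apply; rewrite [leRHS]splitr lerD2r.
Unshelve. all: by end_near. Qed.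

End Characters.

(** * Commutators and semigroups on rays *)

Section ImplementersConvergence.
Context {R : realType} {H : hilbertType R}.
Implicit Types (V W T : boundedOp H).

(** An implementer is determined by its value at one unit vector, V y = a(|y><m|) V m, so strong
    convergence of the endomorphisms and convergence at [m] suffice. The vector [m] is left free
    because the extension to P tests at a vector other than [u]. *)
Lemma implements_cvg {I : Type} {F : set_system I} {FF : Filter F}
    (a : I -> boundedOp H -> boundedOp H) (V : I -> boundedOp H) b W (m : H) :
  `|m| = 1 -> (\forall i \near F, implements (V i) (a i)) -> implements W b ->
  (forall T y, (fun i => a i T y) @ F --> b T y) ->
  (fun i => V i m) @ F --> W m -> forall y, (fun i => V i y) @ F --> W y.
Proof.
move=> m1 Va Wb ab Vm y.
have key V' a' : implements V' a' -> V' y = a' (rank_one y m) (V' m).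
  move=> Va'; rewrite -bop_mulE (implements_intertwine _ Va') bop_mulE rank_oneE.
  by rewrite inner_norm m1 expr1n scale1r.
apply: (@cvg_dist_le _ _ _ _ _ _ _ (fun i =>
    `|W y - a i (rank_one y m) (W m)| + `|y| * `|W m - V i m|)).
  near=> i; have Vi : implements (V i) (a i) by near: i.
  rewrite (key _ _ Vi).
  have -> : W y - a i (rank_one y m) (V i m) =
    (W y - a i (rank_one y m) (W m)) + a i (rank_one y m) (W m - V i m).
    by rewrite bopB addrA subrK.
  rewrite (le_trans (ler_normD _ _))// lerD2l (implements_rank_one _ _ Vi) rank_oneE.
  rewrite normrZ Vi.1 mulrC ler_wpM2l// (le_trans (cauchy_schwarz _ _))//.
  by rewrite Vi.1 m1 mulr1.
have c1 := @cvg_dist0 _ _ _ _ FF _ _ (ab (rank_one y m) (W m)).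
rewrite -(key _ _ Wb) in c1.
have c2 := @cvg_mull0 R[i] _ _ FF `|y| _ (@cvg_dist0 _ _ _ _ FF _ _ Vm).
by have := @cvgD R[i] R[i]^o _ _ FF _ _ _ _ c1 c2; rewrite addr0.
Unshelve. all: by end_near. Qed.

Lemma bop_scale_inj (c e : R[i]) V (x : H) :
  is_isometry V -> `|x| = 1 -> c *: V = e *: V -> c = e.
Proof.
move=> iV x1 /(congr1 (fun T : boundedOp H => T x)); rewrite !bop_scaleE => h.
apply/eqP; rewrite -subr_eq0 -normr_eq0 -[`|_|]mulr1 -x1 -(iV x) -normrZ.
by rewrite scalerBl h subrr normr0.
Qed.

Lemma phase_dist c V W (x : H) : is_isometry W -> `|x| = 1 -> V = c *: W ->
  `|c - 1| = `|V x - W x|.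
Proof.
move=> iW x1 ->; rewrite bop_scaleE.
have -> : c *: W x - W x = (c - 1) *: W x by rewrite scalerBl scale1r.
by rewrite normrZ iW x1 mulr1.
Qed.

Lemma isometry_dist V W (x : H) : is_isometry V ->
  `|(V * W) x - x| <= `|V x - x| + `|W x - x|.
Proof.
move=> iV; have -> : (V * W) x - x = V (W x - x) + (V x - x).
  by rewrite bop_mulE bopB addrA subrK.
by rewrite (le_trans (ler_normD _ _))// iV addrC.
Qed.

End ImplementersConvergence.

Section Commutators.
Context {R : realType} {d : nat} {H : hilbertType R}.
Variables (P : set 'cV[R]_d) (alpha : 'cV[R]_d -> boundedOp H -> boundedOp H).
Hypothesis P_cone : convex_cone P.
Hypothesis alphaE : E_semigroup P alpha.
Variables (u : H) (U : 'cV[R]_d -> boundedOp H).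
Hypothesis u1 : `|u| = 1.
Hypothesis U_impl : forall x, P x -> implements (U x) (alpha x).
Hypothesis U_pos : forall x, P x -> 0 <= inner (U x u) u.
Implicit Types (v w x y : 'cV[R]_d) (s t : R).

Let uu : inner u u = 1. Proof. by rewrite inner_norm u1 expr1n. Qed.

Lemma implements0 : alpha 0 = id. Proof. exact: E_semigroup0 alphaE. Qed.

Lemma implementsD V W x y : P x -> P y -> implements V (alpha x) ->
  implements W (alpha y) -> implements (V * W) (alpha (x + y)).
Proof. by move=> Px Py Vx Wy; rewrite (alphaD alphaE Px Py); exact: implementsM. Qed.

Lemma U0 : U 0 = 1.
Proof.
have P0 := cone0 P_cone; have := U_impl P0; rewrite implements0 => U0i.
have [c1 ->] := implements_unique u1 U0i (implements_id (H := H)).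
by rewrite -(ger0_norm (U_pos P0)) c1 scale1r.
Qed.

(** With r = <U u | u> >= 0 one has |U u - u|^2 = 2 (1 - r) <= 2 (1 - r^2), and r^2 = <alpha(|u><u|)
    u | u> tends to 1. Without the sign condition only |r| would be controlled. *)
Lemma U_cvg v : P v -> (fun t : R => U (t *: v) u) @ 0^'+ --> u.
Proof.
move=> Pv; apply: cvg_norm_sqr.
apply: (@cvg_dist_le R[i] R[i]^o _ _ _ _ _ (fun t : R =>
    2 * `|1 - inner (alpha (t *: v) (rank_one u u) u) u|)).
  near=> t; have Pt : P (t *: v).
    by apply: coneZ => //; near: t; exact: nbhs_right_ge.
  rewrite sub0r normrN normrX normr_id (implements_rank_one _ _ (U_impl Pt)).
  rewrite rank_oneE innerZl -inner_norm innerBl !innerBr (innerC u (U _ u)).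
  set r := inner (U _ u) u; have r0 : 0 <= r by exact: U_pos.
  rewrite (geC0_conj r0) uu inner_norm (U_impl Pt).1 u1 expr1n.
  have -> : 1 - r - (r - 1) = 2 * (1 - r) by ring.
  rewrite ler_wpM2l//.
  have -> : 1 - r * r = (1 - r) * (1 + r) by ring.
  rewrite normrM [`|1 + r|]ger0_norm ?addr_ge0//.
  have r1 : r <= 1.
    by rewrite -(ger0_norm r0) (le_trans (cauchy_schwarz _ _))// (U_impl Pt).1 u1 mulr1.
  by rewrite ger0_norm ?subr_ge0// ler_peMr ?subr_ge0// lerDl.
apply: cvg_mull0.
have c := @alpha_rays_cvg _ _ _ _ _ P_cone alphaE v Pv (rank_one u u) u u.
have e1 : inner (rank_one u u u) u = 1 by rewrite rank_oneE innerZl uu mulr1.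
rewrite e1 in c; exact: (@cvg_dist0 R[i] R[i]^o _ _ _ _ _ c).
Unshelve. all: by end_near. Qed.

Lemma ray_implementers_cvg (V : R -> boundedOp H) v : P v ->
  (\forall t \near 0^'+, implements (V t) (alpha (t *: v))) ->
  V t u @[t --> 0^'+] --> u -> forall y : H, V t y @[t --> 0^'+] --> y.
Proof.
move=> Pv Vv Vu y.
apply: (implements_cvg u1 Vv (implements_id (H := H))) => // T z.
have := @alpha_strong_cvg _ _ _ _ _ alphaE 0 T z (cone0 P_cone).
by rewrite implements0 => c0; exact: cvg_comp (ray_within P_cone Pv) c0.
Qed.

(** The scalar c with [U x * U y = c *: (U y * U x)]. Each factor occurs on both sides, so it is the
    same for every choice of phases, as [commutatorP] records. *)
Definition commutator x y : R[i] := inner ((U x * U y) u) ((U y * U x) u).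

Lemma commutatorP x y V W : P x -> P y -> implements V (alpha x) ->
  implements W (alpha y) -> V * W = commutator x y *: (W * V).
Proof.
move=> Px Py Vx Wy.
have UU := implementsD Px Py (U_impl Px) (U_impl Py).
have := implementsD Py Px (U_impl Py) (U_impl Px); rewrite addrC => UU'.
have [_ UUc] := implements_unique u1 UU UU'.
have [_ ->] := implements_unique u1 Vx (U_impl Px).
have [_ ->] := implements_unique u1 Wy (U_impl Py).
rewrite !bop_scaleAl !bop_scaleAr UUc !scalerA; congr (_ *: _).
by rewrite /commutator; ring.
Qed.

Lemma norm_commutator x y : P x -> P y -> `|commutator x y| = 1.
Proof.
move=> Px Py.
have UU := implementsD Px Py (U_impl Px) (U_impl Py).
have := implementsD Py Px (U_impl Py) (U_impl Px); rewrite addrC => UU'.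
by have [] := implements_unique u1 UU UU'.
Qed.

Lemma commutator_self x : P x -> commutator x x = 1.
Proof.
move=> Px; have iU := (U_impl Px).1.
apply: (bop_scale_inj (isometryM iU iU) u1).
by rewrite scale1r -commutatorP//; exact: U_impl.
Qed.

Lemma commutatorC x y : P x -> P y -> commutator x y * commutator y x = 1.
Proof.
move=> Px Py; have [iU iU'] := ((U_impl Px).1, (U_impl Py).1).
apply: (bop_scale_inj (isometryM iU iU') u1); rewrite scale1r -scalerA.
rewrite -commutatorP; [|by []..|exact: U_impl|exact: U_impl].
by rewrite -commutatorP//; exact: U_impl.
Qed.

Lemma commutatorDl x x' y : P x -> P x' -> P y ->
  commutator (x + x') y = commutator x y * commutator x' y.
Proof.
move=> Px Px' Py; have Ux := U_impl Px; have Ux' := U_impl Px'; have Uy := U_impl Py.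
apply: (bop_scale_inj (isometryM Uy.1 (isometryM Ux.1 Ux'.1)) u1).
rewrite -commutatorP//; [|exact: coneD|exact: implementsD].
rewrite -mulrA (commutatorP Px' Py Ux' Uy) bop_scaleAr mulrA (commutatorP Px Py Ux Uy).
by rewrite bop_scaleAl scalerA -mulrA mulrC.
Qed.

(** Multiplicativity is [commutatorDl]. Continuity at 0 needs [U (t *: v)] to converge at [U y u] as
    well as at [u], hence the detour through [ray_implementers_cvg]. *)
Lemma commutator_character v y : P v -> P y ->
  character (fun s => commutator (s *: v) y).
Proof.
move=> Pv Py; split=> [t t0|s t s0 t0|].
- by rewrite norm_commutator//; exact: coneZ.
- by rewrite scalerDl commutatorDl//; exact: coneZ.
have Vu := U_cvg Pv; have iUy := (U_impl Py).1.
have Vx : forall z, (fun t : R => U (t *: v) z) @ 0^'+ --> z.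
  apply: (ray_implementers_cvg Pv) => //; near=> t.
  have t0 : 0 <= t by near: t; exact: nbhs_right_ge.
  exact: U_impl (coneZ P_cone t0 Pv).
apply: (@cvg_dist_le R[i] R[i]^o _ _ _ _ _ (fun t : R =>
    `|U y u - U (t *: v) (U y u)| + `|u - U (t *: v) u|)).
  near=> t; have Pt : P (t *: v).
    by apply: coneZ => //; near: t; exact: nbhs_right_ge.
  have Ut := U_impl Pt; have Uy := U_impl Py.
  rewrite distrC (phase_dist (isometryM Uy.1 Ut.1) u1 (commutatorP Pt Py Ut Uy)).
  rewrite -(iUy (u - _)) bopB !bop_mulE -normrN opprB.
  rewrite [X in _ <= X + _]distrC [X in _ <= X]addrC.
  have -> : U y (U (t *: v) u) - U (t *: v) (U y u) =
    - (U y u - U y (U (t *: v) u)) - (U (t *: v) (U y u) - U y u).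
    by rewrite opprB opprB addrA subrK.
  by rewrite (le_trans (ler_normB _ _))// normrN.
have F0 : Filter (0 : R)^'+ by typeclasses eauto.
have c1 := @cvg_dist0 _ _ _ _ F0 _ _ (Vx (U y u)).
have c2 := @cvg_dist0 _ _ _ _ F0 _ _ Vu.
by have := @cvgD R[i] R[i]^o _ _ F0 _ _ _ _ c1 c2; rewrite addr0.
Unshelve. all: by end_near. Qed.

Lemma commutator_bicharacter v w : P v -> P w ->
  exists k, forall s t, 0 <= s -> 0 <= t -> commutator (s *: v) (t *: w) = expi (k * s * t).
Proof.
move=> Pv Pw; apply: bicharacterP => [s s0|t t0]; last first.
  by apply: commutator_character => //; exact: coneZ.
have Ps := coneZ P_cone s0 Pv.
have [c1 c2 c3] := commutator_character Pw Ps.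
(* The second variable reduces to the first: on the circle, the inverse provided by [commutatorC] is
   the conjugate. *)
have cC t : 0 <= t -> commutator (s *: v) (t *: w) = (commutator (t *: w) (s *: v))^*.
  move=> t0; have Pt := coneZ P_cone t0 Pw.
  have c0 : commutator (t *: w) (s *: v) != 0.
    by rewrite -normr_eq0 norm_commutator// oner_eq0.
  by apply: (mulfI c0); rewrite -normCK norm_commutator// expr1n commutatorC.
split=> [t t0|t t' t0 t'0|]; first by rewrite norm_commutator//; exact: coneZ.
  by rewrite !cC ?addr_ge0// c2// rmorphM.
have F0 : Filter (0 : R)^'+ by typeclasses eauto.
have := cvg_complex_conj (FF := F0) c3; rewrite rmorph1.
apply: cvg_trans; apply: near_eq_cvg; near=> t.
by apply/esym/cC; near: t; exact: nbhs_right_ge.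
Unshelve. all: by end_near. Qed.

(** Every r >= 0 is a product of sqrt r with itself, and an operator commutes with itself, so exp(i
    k r) = 1 for all r >= 0. *)
Lemma ray_commute v s t : P v -> 0 <= s -> 0 <= t -> commutator (s *: v) (t *: v) = 1.
Proof.
move=> Pv s0 t0; have [k kE] := commutator_bicharacter Pv Pv.
suff k0 : k = 0 by rewrite kE// k0 !mul0r expi0.
apply: expi_lin_eq1 => r r0.
rewrite -(sqr_sqrtr r0) expr2 mulrA -kE ?sqrtr_ge0// commutator_self//.
by apply: coneZ; rewrite ?sqrtr_ge0.
Qed.

Lemma implementsX V x n : P x -> implements V (alpha x) ->
  implements (V ^+ n) (alpha (n%:R *: x)).
Proof.
move=> Px Vx; elim: n => [|n IH].
  by rewrite expr0 scale0r implements0; exact: implements_id.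
rewrite exprS -nat1r scalerDl scale1r; apply: implementsD => //.
exact: (coneZ P_cone).
Qed.

Lemma ray_implementers_commute v s t V W : P v -> 0 <= s -> 0 <= t ->
  implements V (alpha (s *: v)) -> implements W (alpha (t *: v)) -> V * W = W * V.
Proof.
move=> Pv s0 t0 Vs Wt.
rewrite (commutatorP (coneZ P_cone s0 Pv) (coneZ P_cone t0 Pv) Vs Wt).
by rewrite ray_commute// scale1r.
Qed.

(* V t = U (e v)^n U (q v) for t = n e + q: since U (e v) commutes with the
   U (q v), the cocycle of V stays as close to 1 as that of U on [0, 2e]. *)
Lemma ray_bounded_cocycle v (r : R) : P v -> 0 < r ->
  exists V : R -> boundedOp H,
    [/\ forall t, 0 <= t -> implements (V t) (alpha (t *: v)),
        forall s t, 0 <= s -> 0 <= t ->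
          `|(V s * V t) u - V (s + t) u| < r%:C%C &
        V t u @[t --> 0^'+] --> u].
Proof.
move=> Pv r0.
pose nu t := `|U (t *: v) u - u|.
have r40 : 0 < r%:C%C / 4 :> R[i] by rewrite divr_gt0// ltcR.
have nu0 : nu 0 = 0 by rewrite /nu scale0r U0 subrr normr0.
have [e e0 nue] : exists2 e : R, 0 < e & forall t, 0 <= t -> t <= 2 * e -> nu t < r%:C%C / 4.
  have [e /= e0 he] : \forall t \near 0^'+, `|u - U (t *: v) u| < r%:C%C / 4.
    by move: (U_cvg Pv) => /cvgrPdist_lt/(_ _ r40).
  exists (e / 4) => [|t]; first by rewrite divr_gt0.
  rewrite le_eqVlt => /predU1P[<- _|t0 te]; first by rewrite nu0.
  rewrite /nu distrC; apply: he => //=; rewrite sub0r normrN gtr0_norm//.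
  by rewrite (le_lt_trans te)//; lra.
pose n t := Num.truncn (t / e); pose q t := t - (n t)%:R * e.
have nq t : t = (n t)%:R * e + q t by rewrite /q addrC subrK.
have qP t : 0 <= t -> 0 <= q t /\ q t < e.
  move=> t0; have te : 0 <= t / e by rewrite divr_ge0// ltW.
  have /andP[h1 h2] := truncn_itv te; split.
    by rewrite subr_ge0 -ler_pdivlMr.
  by rewrite ltrBlDl -[X in _ < _ + X]mul1r -mulrDl addrC nat1r -ltr_pdivrMr.
pose V t := U (e *: v) ^+ n t * U (q t *: v).
have Pt t : 0 <= t -> P (t *: v) by move=> t0; exact: (coneZ P_cone).
have Ut t : 0 <= t -> implements (U (t *: v)) (alpha (t *: v)).
  by move=> t0; exact/U_impl/Pt.
have Pe := Pt e (ltW e0); have Ue := Ut e (ltW e0).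
have iV t : 0 <= t -> implements (V t) (alpha (t *: v)).
  move=> t0; have [q0 _] := qP t t0.
  rewrite [X in alpha (X *: _)]nq scalerDl -scalerA.
  apply: implementsD; [exact: (coneZ P_cone)|exact: Pt|exact: implementsX|exact: Ut].
(* Once the common power of [U (e *: v)] is cancelled, both sides of the estimate are products of
   two operators with parameters in [0, 2e]. Each of the four factors moves [u] by less than r /
   4. *)
have two s t s' t' : 0 <= s -> s <= 2 * e -> 0 <= t -> t <= 2 * e ->
    0 <= s' -> s' <= 2 * e -> 0 <= t' -> t' <= 2 * e ->
    `|(U (s *: v) * U (t *: v)) u - (U (s' *: v) * U (t' *: v)) u| < r%:C%C.
  move=> s0 se t0 te s'0 s'e t'0 t'e.
  have -> : r%:C%C = (r%:C%C / 4 + r%:C%C / 4) + (r%:C%C / 4 + r%:C%C / 4) by field.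
  rewrite (_ : _ - _ = ((U (s *: v) * U (t *: v)) u - u)
     - ((U (s' *: v) * U (t' *: v)) u - u)); last by rewrite opprB addrA subrK.
  rewrite (le_lt_trans (ler_normB _ _))//.
  apply: ltrD; apply: (le_lt_trans (isometry_dist _ _ (Ut _ _).1)) => //;
    by apply: ltrD; exact: nue.
exists V; split=> // [s t s0 t0|].
  have [[qs0 qse] [qt0 qte]] := (qP s s0, qP t t0).
  have [q0 qe] := qP (s + t) (addr_ge0 s0 t0).
  have VV : V s * V t = U (e *: v) ^+ (n s + n t) * (U (q s *: v) * U (q t *: v)).
    rewrite /V exprD -!mulrA; congr (_ * _); rewrite !mulrA; congr (_ * _).
    apply: GRing.commrX; apply: (ray_implementers_commute Pv qs0 (ltW e0)) => //.
    exact: Ut.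
  have iE k : is_isometry (U (e *: v) ^+ k) := (implementsX k Pe Ue).1.
  have eqn : (n (s + t))%:R * e + q (s + t) = (n s + n t)%:R * e + (q s + q t).
    by rewrite -nq natrD mulrDl addrACA -!nq.
  have le2 : e <= 2 * e by rewrite mulr_natl mulr2n lerDl ltW.
  have [nst|nst] : n (s + t)%R = (n s + n t)%N \/ n (s + t)%R = (n s + n t).+1.
  - apply: (euclid_carry e0 q0 qe _ _ eqn); first exact: addr_ge0.
    by rewrite mulr_natl mulr2n ltrD.
  (* Without carry, U(0) = 1 is inserted to make a product of two factors; with carry, the extra
     [U (e *: v)] is the second factor. *)
  - rewrite VV /V nst (_ : U (q (s + t) *: v) = U (0 *: v) * U (q (s + t) *: v)).
      rewrite !(bop_mulE (_ ^+ _)) -bopB iE.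
      move: eqn; rewrite nst => /addrI qq.
      by apply: two => //; lra.
    by rewrite scale0r U0 mul1r.
  rewrite VV /V nst exprSr -mulrA !(bop_mulE (_ ^+ _)) -bopB iE.
  by apply: two => //; lra.
have Vt : \forall t \near 0^'+, U (t *: v) u = V t u.
  near=> t; have t0 : 0 <= t by near: t; exact: nbhs_right_ge.
  have te : t < e by near: t; exact: nbhs_right_lt.
  have [qt0 qte] := qP t t0.
  suff nt : n t = 0%N by rewrite /V [X in U (X *: _)]nq nt expr0 mul1r mul0r add0r.
  apply/eqP; rewrite -leqn0 leqNgt; apply/negP => nt.
  have : 1 * e <= (n t)%:R * e by rewrite ler_wpM2r ?(ltW e0)// ler1n.
  by have := nq t; clear nt; lra.
by apply: cvg_trans (U_cvg Pv); exact: near_eq_cvg.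
Unshelve. all: by end_near. Qed.

(** The function [g] makes the multiplier [D] of the corrected family [W] trivial on the diagonal,
    so [W (2 * p) = W p * W p]. Commutation along the ray then gives
    [D (2 * s) (2 * t) = D s t ^+ 2], and [circle_eq1] finishes. *)
Lemma ray_semigroup v : P v -> exists W : R -> boundedOp H,
  [/\ forall t, 0 <= t -> implements (W t) (alpha (t *: v)),
      forall s t, 0 <= s -> 0 <= t -> W (s + t) = W s * W t &
      forall y : H, W t y @[t --> 0^'+] --> y].
Proof.
move=> Pv.
(* The argument of [D s t] is a sum of four terms of size at most 1/8, hence at most 1/2, which
   keeps its real part positive. *)
have [r r0 small] := @arg_small R 8^-1 ltac:(by rewrite invr_gt0).
have [V [iV Vd Vu]] := ray_bounded_cocycle Pv r0.
pose w s t := inner ((V s * V t) u) (V (s + t) u).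
have VV s t : 0 <= s -> 0 <= t -> implements (V s * V t) (alpha ((s + t) *: v)).
  move=> s0 t0; rewrite scalerDl; apply: implementsD; [| |exact: iV|exact: iV];
    exact: (coneZ P_cone).
have wP s t : 0 <= s -> 0 <= t -> `|w s t| = 1 /\ V s * V t = w s t *: V (s + t).
  by move=> s0 t0; apply: implements_unique u1 (VV _ _ s0 t0) (iV _ (addr_ge0 s0 t0)).
have w_dist s t : 0 <= s -> 0 <= t -> `|w s t - 1| = `|(V s * V t) u - V (s + t) u|.
  move=> s0 t0; exact: phase_dist (iV _ (addr_ge0 s0 t0)).1 u1 (wP _ _ s0 t0).2.
have wsmall s t : 0 <= s -> 0 <= t -> `|arg (w s t)| < 8^-1 /\ expi (arg (w s t)) = w s t.
  move=> s0 t0; have [|a8 re] := small (w s t); first by rewrite w_dist// Vd.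
  by split=> //; apply: expi_arg => //; exact: (wP _ _ s0 t0).1.
have w_cvg : w t t @[t --> 0^'+] --> (1 : R[i]^o).
  have F0 : Filter (0 : R)^'+ by typeclasses eauto.
  apply: (@cvg_dist_le R[i] R[i]^o _ _ _ _ _ (fun t : R =>
     (`|u - V t u| + `|u - V t u|) + `|u - V (2 * t) u|)).
    near=> t; have t0 : 0 <= t by near: t; exact: nbhs_right_ge.
    rewrite distrC w_dist// mulr_natl mulr2n.
    rewrite (_ : _ - _ = ((V t * V t) u - u) + (u - V (t + t) u)); last first.
      by rewrite addrA subrK.
    rewrite (le_trans (ler_normD _ _))// lerD2r.
    rewrite (le_trans (isometry_dist _ _ (iV t t0).1))//.
    by rewrite ![`|u - _|]distrC.
  have c1 := @cvg_dist0 _ _ _ _ F0 _ _ Vu.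
  have c2 := cvg_comp _ _ cvg_double_right c1.
  have := @cvgD R[i] R[i]^o _ _ F0 _ _ _ _ (@cvgD R[i] R[i]^o _ _ F0 _ _ _ _ c1 c1) c2.
  by rewrite !addr0.
have [|g [gle g2 g0]] := hyers_series (e := 8^-1) _ (cvg_arg w_cvg).
  by move=> t t0; apply/ltW; have [] := wsmall t t t0 t0.
pose D s t := expi (g s + g t - g (s + t)) * w s t.
pose W t := expi (g t) *: V t.
have iW t : 0 <= t -> implements (W t) (alpha (t *: v)).
  by move=> t0; apply: implementsZ; [exact: norm_expi|exact: iV].
have WD s t : 0 <= s -> 0 <= t -> W s * W t = D s t *: W (s + t).
  move=> s0 t0; rewrite /W bop_scaleAl bop_scaleAr (wP s t s0 t0).2 !scalerA.
  by congr (_ *: _); rewrite /D [RHS]mulrAC -[in RHS]expiD subrK expiD; ring.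
have inj s t (c e : R[i]) : 0 <= s -> 0 <= t -> c *: W (s + t) = e *: W (s + t) -> c = e.
  by move=> s0 t0; apply: bop_scale_inj u1; exact: (iW _ (addr_ge0 s0 t0)).1.
have D1 t : 0 <= t -> D t t = 1.
  move=> t0; rewrite /D -(wsmall t t t0 t0).2 -expiD -[t + t]mulr2n -mulr_natl g2//.
  by rewrite (_ : _ + _ = 0) ?expi0//; ring.
have Dnorm s t : 0 <= s -> 0 <= t -> `|D s t| = 1.
  by move=> s0 t0; rewrite /D normrM norm_expi mul1r (wP s t s0 t0).1.
have DRe s t : 0 <= s -> 0 <= t -> 0 < complex.Re (D s t).
  move=> s0 t0; have [a8 ae] := wsmall s t s0 t0.
  rewrite /D -ae -expiD /=; apply: cos_gt0_lt1.
  have := gle _ s0; have := gle _ t0; have := gle _ (addr_ge0 s0 t0).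
  move: a8; rewrite !(ler_norml, ltr_norml).
  move=> /andP[? ?] /andP[? ?] /andP[? ?] /andP[? ?]; apply/andP; split; lra.
have Ddouble s t : 0 <= s -> 0 <= t -> D (2 * s) (2 * t) = D s t ^+ 2.
  move=> s0 t0; have st0 := addr_ge0 s0 t0.
  have W2 p : 0 <= p -> W (2 * p) = W p * W p.
    by move=> p0; rewrite WD// D1// scale1r mulr_natl.
  have s20 : 0 <= 2 * s by rewrite mulr_ge0.
  have t20 : 0 <= 2 * t by rewrite mulr_ge0.
  apply: (inj (2 * s) (2 * t)) => //; rewrite -WD// -mulrDr !W2//.
  rewrite -mulrA [W s * (W t * W t)]mulrA.
  rewrite (ray_implementers_commute Pv s0 t0 (iW _ s0) (iW _ t0)).
  rewrite -[W t * W s * W t]mulrA mulrA WD//.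
  by rewrite bop_scaleAl bop_scaleAr scalerA expr2.
have Dpow n s t : 0 <= s -> 0 <= t -> D s t ^+ (2 ^ n) = D (2 ^+ n * s) (2 ^+ n * t).
  move=> s0 t0; elim: n => [|n IH]; first by rewrite !expr0 !mul1r expr1.
  rewrite expnSr exprM IH -Ddouble ?mulr_ge0 ?exprn_ge0//.
  by rewrite !mulrA -!exprS.
have Dall s t : 0 <= s -> 0 <= t -> D s t = 1.
  move=> s0 t0; apply: circle_eq1 => [|n]; first exact: Dnorm.
  by rewrite Dpow// DRe// mulr_ge0// exprn_ge0.
exists W; split=> // [s t s0 t0|]; first by rewrite WD// Dall// scale1r.
apply: (ray_implementers_cvg Pv).
  near=> t; have t0 : 0 <= t by near: t; exact: nbhs_right_ge.
  exact: iW.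
have := cvgZ (cvg_expi g0) Vu; rewrite expi0 scale1r; exact.
Unshelve. all: by end_near. Qed.

End Commutators.

(** * From rays to the cone *)

Lemma cvg_sum_seq {K : numFieldType} {V : normedModType K} {I J : Type}
    {F : set_system I} {FF : Filter F} (r : seq J) (f : J -> I -> V) (l : J -> V) :
  (forall j, f j @ F --> l j) ->
  (fun t => \sum_(j <- r) f j t) @ F --> \sum_(j <- r) l j.
Proof.
move=> fl; elim: r => [|j r IH].
  by under eq_fun do rewrite big_nil; rewrite big_nil; exact: cvg_cst.
under eq_fun do rewrite big_cons; rewrite big_cons.
by have := @cvgD _ _ _ _ FF _ _ _ _ (fl j) IH.
Qed.

(** * Linear and bilinear forms, and a basis inside the cone *)

Section LinearAlgebra.
Context {R : realType} {d : nat}.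
Implicit Types (x y : 'cV[R]_d) (M S A : 'M[R]_d).

Lemma scalar_cV_sum (f : 'cV[R]_d -> R) x : scalar f ->
  f x = \sum_i x i 0 * f (delta_mx i 0).
Proof.
move=> lf; have fD p q : f (p + q) = f p + f q.
  by have := lf 1 p q; rewrite scale1r mul1r.
have f0 : f 0 = 0 by apply: (addrI (f 0)); rewrite -fD !addr0.
have fZ a p : f (a *: p) = a * f p by have := lf a p 0; rewrite f0 !addr0.
rewrite {1}[x]matrix_sum_delta.
rewrite (big_morph f fD f0); apply: eq_bigr => i _.
by rewrite big_ord1 fZ.
Qed.

Lemma scalar_cV_continuous (f : 'cV[R]_d -> R) : scalar f -> continuous f.
Proof.
move=> lf; have -> : f = fun x => \sum_i x i 0 * f (delta_mx i 0).
  by apply/funext => x; exact: scalar_cV_sum.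
move=> x; apply: (@cvg_sum_seq R R^o _ _ _ (nbhs_filter x)) => i; apply: cvgMr_tmp.
exact: coord_continuous.
Qed.

Lemma dotvDl x y z : dotv (x + y) z = dotv x z + dotv y z.
Proof. by rewrite /dotv -big_split; apply: eq_bigr => i _; rewrite mxE mulrDl. Qed.

Lemma dotvDr x y z : dotv x (y + z) = dotv x y + dotv x z.
Proof. by rewrite /dotv -big_split; apply: eq_bigr => i _; rewrite mxE mulrDr. Qed.

Lemma dotv_mulmx M x y : dotv (M *m x) y = \sum_i \sum_j M i j * x j 0 * y i 0.
Proof. by apply: eq_bigr => i _; rewrite mxE mulr_suml. Qed.

Lemma bilinear_dotv (f : 'cV[R]_d -> 'cV[R]_d -> R) :
  (forall y, scalar (f^~ y)) -> (forall x, scalar (f x)) ->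
  exists M, forall x y, f x y = dotv (M *m x) y.
Proof.
move=> fl fr; exists (\matrix_(i, j) f (delta_mx j 0) (delta_mx i 0)) => x y.
rewrite dotv_mulmx (scalar_cV_sum _ (fr x)); apply: eq_bigr => i _.
rewrite (scalar_cV_sum _ (fl _)) mulr_sumr; apply: eq_bigr => j _.
by rewrite mxE; ring.
Qed.

Lemma dotv_quadratic_continuous M : continuous (fun x => dotv (M *m x) x).
Proof.
move=> x; apply: (@cvg_sum_seq R R^o _ _ _ (nbhs_filter x)) => i.
apply: cvgM; last exact: coord_continuous.
apply: (@scalar_cV_continuous (fun x => (M *m x) i 0)) => a p q.
by rewrite mulmxDr -scalemxAr !mxE.
Qed.

(* The symmetric form M - A is the coboundary of x |-> (M - A)(x, x) / 2, so the
   cocycles M and A are cohomologous. *)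
Lemma symmetrize M : exists A, strictly_upper_triangular A /\
  forall x y, dotv ((M - A) *m x) y = dotv ((M - A) *m y) x.
Proof.
exists (\matrix_(i, j) if (i < j)%N then M i j - M j i else 0); split.
  by move=> i j ji; rewrite mxE ltnNge ji.
move=> x y; rewrite !dotv_mulmx exchange_big; apply: eq_bigr => i _.
apply: eq_bigr => j _; rewrite mulrAC; congr (_ * _ * _); rewrite !mxE.
by have [ij|ij|/val_inj ->] := ltngtP i j; rewrite // ?subr0 ?subKr.
Qed.

(** Standard basis vectors are differences of points of P, so those 2d points span and d independent
    ones can be selected among them. Indices are natural numbers, to fit ordered products; basis
    vectors and coordinates are 0 from d on. *)
Lemma cone_basis (P : set 'cV[R]_d) : P 0 -> spanning P ->
  exists (b : nat -> 'cV[R]_d) (co : nat -> 'cV[R]_d -> R),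
    [/\ forall i, P (b i), forall i, scalar (co i),
        forall i x, (d <= i)%N -> co i x = 0,
        forall x, x = \sum_(0 <= i < d) co i x *: b i &
        forall t i, (i < d)%N -> co i (\sum_(0 <= j < d) t j *: b j) = t i].
Proof.
move=> P0 spP.
have /choice[pq pqP] : forall j : 'I_d, exists pq : 'cV[R]_d * 'cV[R]_d,
    [/\ P pq.1, P pq.2 & delta_mx j 0 = pq.1 - pq.2].
  move=> j; have [p Pp [q Pq pqE]] : [set x - y | x in P & y in P] (delta_mx j 0).
    by rewrite spP.
  by exists (p, q).
pose M : 'M[R]_(d + d, d) :=
  col_mx (\matrix_j (pq j).1^T) (\matrix_j (pq j).2^T).
have Mfull : row_full M.
  rewrite -sub1mx.
  have -> : 1%:M = row_mx 1%:M (- 1%:M) *m M.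
    rewrite mul_row_col mul1mx mulNmx mul1mx; apply/matrixP => i j.
    have [_ _ /(congr1 (fun A : 'cV[R]_d => A j 0))] := pqP i.
    by rewrite !mxE eqxx andbT eq_sym => ->.
  exact: submxMl.
pose B := (rowsub (fullrankfun Mfull) M)^T.
have uB : B \in unitmx by rewrite unitmx_tr fullrowsub_unit.
have PB (i : 'I_d) : P (col i B).
  have -> : col i B = (row (fullrankfun Mfull i) M)^T.
    by apply/matrixP => k l; rewrite !mxE.
  case: (split_ordP (fullrankfun Mfull i)) => j ->.
    rewrite rowKu rowK trmxK; by have [] := pqP j.
  rewrite rowKd rowK trmxK; by have [] := pqP j.
exists (fun i => if insub i is Some k then col k B else 0).
exists (fun i x => if insub i is Some k then (invmx B *m x) k 0 else 0).
have sumE (t : nat -> R) :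
    \sum_(0 <= j < d) t j *: (if insub j is Some k then col k B else 0) =
    B *m (\col_(j < d) t j).
  rewrite big_mkord; apply/matrixP => i j; rewrite summxE mxE; apply: eq_bigr => k _.
  by rewrite valK !mxE mulrC.
split=> [i|i|i x di|x|t i id].
- by case: insubP => // k _ _.
- case: insubP => [k _ _|_] a p q; last by rewrite mulr0 addr0.
  by rewrite mulmxDr -scalemxAr !mxE.
- by rewrite insubF// ltnNge di.
- rewrite sumE -[LHS](mulKVmx uB); congr (_ *m _); apply/matrixP => i j.
  by rewrite !mxE valK mxE ord1.
by rewrite sumE mulKmx// insubT mxE.
Qed.

End LinearAlgebra.

Section SemigroupContinuity.
Context {R : realType} {H : hilbertType R}.

Lemma isometry_cvg_comp {I : Type} {F : set_system I} {FF : Filter F}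
    (V : I -> boundedOp H) (V0 : boundedOp H) (z : I -> H) (z0 : H) :
  (\forall i \near F, is_isometry (V i)) ->
  (forall y, V i y @[i --> F] --> V0 y) -> z @ F --> z0 ->
  V i (z i) @[i --> F] --> V0 z0.
Proof.
move=> iV VV0 zz0.
apply: (@cvg_dist_le _ _ _ _ _ _ _ (fun i => `|V0 z0 - V i z0| + `|z0 - z i|)).
  near=> i; have iVi : is_isometry (V i) by near: i.
  have -> : V0 z0 - V i (z i) = (V0 z0 - V i z0) + V i (z0 - z i).
    by rewrite bopB addrA subrK.
  by rewrite (le_trans (ler_normD _ _))// iVi.
have c1 := @cvg_dist0 _ _ _ _ FF _ _ (VV0 z0).
have c2 := @cvg_dist0 _ _ _ _ FF _ _ zz0.
by have := @cvgD R[i] R[i]^o _ _ FF _ _ _ _ c1 c2; rewrite addr0.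
Unshelve. all: by end_near. Qed.

(** For p <= t, |W t y - W p y| = |W (t - p) y - y| by the isometry property, so continuity
    everywhere reduces to continuity at 0. *)
Lemma semigroup_cvg (W : R -> boundedOp H) {I : Type} {F : set_system I}
    {FF : Filter F} (s : I -> R) (s0 : R) :
  (forall t, 0 <= t -> is_isometry (W t)) ->
  (forall p t, 0 <= p -> 0 <= t -> W (p + t) = W p * W t) ->
  (forall y : H, W t y @[t --> 0^'+] --> y) ->
  0 <= s0 -> (\forall i \near F, 0 <= s i) -> s @ F --> s0 ->
  forall y, W (s i) y @[i --> F] --> W s0 y.
Proof.
move=> iW WD W0 s00 sge ss0 y.
have W00 : W 0 y = y.
  have := congr1 (fun T : boundedOp H => T y) (WD 0 0 (lexx 0) (lexx 0)).
  rewrite addr0 bop_mulE => h; apply/eqP; rewrite -subr_eq0 -normr_eq0.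
  by rewrite -(iW 0 (lexx 0)) bopB -h subrr normr0.
have dist p t : 0 <= p -> p <= t -> `|W t y - W p y| = `|W (t - p) y - y|.
  move=> p0 pt; have -> : W t = W p * W (t - p).
    by rewrite -WD ?subr_ge0// addrC subrK.
  by rewrite bop_mulE -bopB iW.
apply/cvgrPdist_lt => e e0.
have := W0 y => /cvgrPdist_lt/(_ _ e0)[r /= r0 rW].
have rW' t : 0 <= t -> t < r -> `|W t y - y| < e.
  rewrite le_eqVlt => /predU1P[<- _|t0 tr]; first by rewrite W00 subrr normr0.
  by rewrite distrC; apply: rW => //=; rewrite sub0r normrN gtr0_norm.
have sr : \forall i \near F, `|s0 - s i| < r by move/cvgrPdist_lt: ss0; apply.
near=> i; have si0 : 0 <= s i by near: i.
have sir : `|s0 - s i| < r by near: i.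
have [ss|ss] := leP s0 (s i).
  rewrite distrC dist//; apply: rW'; first by rewrite subr_ge0.
  by rewrite -(ger0_norm (_ : 0 <= s i - s0)) ?subr_ge0// distrC.
rewrite dist//; last exact: ltW.
apply: rW'; first by rewrite subr_ge0 ltW.
by rewrite -(gtr0_norm (_ : 0 < s0 - s i)) ?subr_gt0.
Unshelve. all: by end_near. Qed.

End SemigroupContinuity.

(** * Ordered products of semigroups and their multiplier *)

Section OrderedProducts.
Context {R : realType} {H : hilbertType R}.
Variables (W : nat -> R -> boundedOp H) (k : nat -> nat -> R).
Hypothesis W_iso : forall i t, 0 <= t -> is_isometry (W i t).
Hypothesis W_add : forall i s t, 0 <= s -> 0 <= t -> W i (s + t) = W i s * W i t.
Hypothesis W_cvg0 : forall i (y : H), W i t y @[t --> 0^'+] --> y.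
Hypothesis W_comm : forall i j s t, 0 <= s -> 0 <= t ->
  W i s * W j t = expi (k i j * s * t) *: (W j t * W i s).
Implicit Types (a b : nat -> R).

Definition ordered_prod n a : boundedOp H := \prod_(0 <= i < n) W i (a i).

Lemma ordered_prodS n a : ordered_prod n.+1 a = ordered_prod n a * W n (a n).
Proof. by rewrite /ordered_prod big_nat_recr. Qed.

Lemma ordered_prod_isometry n a : (forall i, 0 <= a i) -> is_isometry (ordered_prod n a).
Proof.
move=> a0; elim: n => [|n IH]; first by rewrite /ordered_prod big_nil.
by rewrite ordered_prodS; apply: isometryM => //; exact: W_iso.
Qed.

Lemma ordered_prod_comm n a m s : (forall i, 0 <= a i) -> 0 <= s ->
  W m s * ordered_prod n a =
  expi (\sum_(0 <= j < n) k m j * s * a j) *: (ordered_prod n a * W m s).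
Proof.
move=> a0 s0; elim: n => [|n IH].
  by rewrite /ordered_prod !big_nil mulr1 mul1r expi0 scale1r.
rewrite ordered_prodS big_nat_recr//= mulrA IH bop_scaleAl -mulrA W_comm//.
by rewrite bop_scaleAr scalerA -expiD mulrA.
Qed.

(** Reordering a product of two ordered products moves [W i (a i)] past [W j (b j)] only for
    [j < i]. *)
Definition prod_phase n a b : R :=
  \sum_(0 <= i < n) \sum_(0 <= j < i) k i j * a i * b j.

Lemma ordered_prodM n a b : (forall i, 0 <= a i) -> (forall i, 0 <= b i) ->
  ordered_prod n a * ordered_prod n b =
  expi (prod_phase n a b) *: ordered_prod n (fun i => a i + b i).
Proof.
move=> a0 b0; elim: n => [|n IH].
  by rewrite /ordered_prod /prod_phase !big_nil mulr1 expi0 scale1r.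
rewrite !ordered_prodS {1}/prod_phase big_nat_recr//= -/(prod_phase n a b).
rewrite -mulrA [W n (a n) * _]mulrA ordered_prod_comm// bop_scaleAl bop_scaleAr.
rewrite -mulrA mulrA IH -W_add// bop_scaleAl scalerA.
by rewrite addrC expiD.
Qed.

Lemma ordered_prod_cvg n {I : Type} {F : set_system I} {FF : Filter F}
    (a : I -> nat -> R) (a0 : nat -> R) : (forall i, 0 <= a0 i) ->
  (\forall t \near F, forall i, 0 <= a t i) -> (forall i, a t i @[t --> F] --> a0 i) ->
  forall y, ordered_prod n (a t) y @[t --> F] --> ordered_prod n a0 y.
Proof.
move=> a00 age aa0; elim: n => [|n IH] y.
  by rewrite /ordered_prod; under eq_fun do rewrite big_nil; rewrite big_nil; exact: cvg_cst.
under eq_fun do rewrite ordered_prodS bop_mulE.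
rewrite ordered_prodS bop_mulE; apply: isometry_cvg_comp => //.
  by move: age; apply: filterS => t ta; exact: ordered_prod_isometry.
apply: semigroup_cvg => //.
- by move=> t t0; exact: W_iso.
- by move=> p t p0 t0; exact: W_add.
- by move: age; apply: filterS => t ta.
Qed.

End OrderedProducts.

(** * Extension from an absorbing subcone to the whole cone *)

Section Extension.
Context {R : realType} {d : nat} {H : hilbertType R}.
Variables (P : set 'cV[R]_d) (alpha : 'cV[R]_d -> boundedOp H -> boundedOp H).
Hypothesis P_cone : convex_cone P.
Hypothesis alphaE : E_semigroup P alpha.
Variables (u : H) (U : 'cV[R]_d -> boundedOp H).
Hypothesis u1 : `|u| = 1.
Hypothesis U_impl : forall x, P x -> implements (U x) (alpha x).
Variables (Q : set 'cV[R]_d) (Z : 'cV[R]_d -> boundedOp H).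
Variable phi : 'cV[R]_d -> 'cV[R]_d -> R.
Hypothesis QP : Q `<=` P.
Hypothesis QD : forall x y, Q x -> Q y -> Q (x + y).
Hypothesis Q_near : forall x : 'cV[R]_d, exists2 y, Q y & \forall t \near x, Q (t + y).
Hypothesis phiDl : forall x y z, phi (x + y) z = phi x z + phi y z.
Hypothesis phiDr : forall x y z, phi x (y + z) = phi x y + phi x z.
Hypothesis phi_continuous : forall y, continuous (fun x : 'cV[R]_d => phi x y).
Hypothesis Z_impl : forall x, Q x -> implements (Z x) (alpha x).
Hypothesis ZM : forall x y, Q x -> Q y -> Z x * Z y = expi (phi x y) *: Z (x + y).
Hypothesis Z_cvg : forall (x : 'cV[R]_d) (w : H), Q x ->
  Z t w @[t --> within Q (nbhs x)] --> Z x w.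
Implicit Types (x y z : 'cV[R]_d).

Let Q_absorb x : exists2 y, Q y & Q (x + y).
Proof. by have [y Qy Qn] := Q_near x; exists y => //; exact: nbhs_singleton Qn. Qed.

(* The equation for a single y fixes the phase of V; the cocycle identity then
   gives it for every other y. *)
Lemma extension_pointwise x : P x -> exists V, implements V (alpha x) /\
  forall y, Q y -> Q (x + y) -> V * Z y = expi (phi x y) *: Z (x + y).
Proof.
move=> Px; have [z Qz Qxz] := Q_absorb x.
have Zi y : Q y -> is_isometry (Z y) by move=> Qy; exact: (Z_impl Qy).1.
have UZ := implementsD alphaE Px (QP Qz) (U_impl Px) (Z_impl Qz).
have [] := implements_unique u1 UZ (Z_impl Qxz).
set c := inner _ _ => c1 UZc.
have c0 : c != 0 by rewrite -normr_eq0 c1 oner_eq0.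
pose V := (c^-1 * expi (phi x z)) *: U x.
have Vx : implements V (alpha x).
  apply: implementsZ; last exact: U_impl.
  by rewrite normrM normfV c1 invr1 mul1r norm_expi.
have Vz : V * Z z = expi (phi x z) *: Z (x + z).
  by rewrite bop_scaleAl UZc scalerA mulrAC mulVf// mul1r.
exists V; split=> // y Qy Qxy.
have VZ := implementsD alphaE Px (QP Qy) Vx (Z_impl Qy).
have [] := implements_unique u1 VZ (Z_impl Qxy).
set e := inner _ _ => e1 VZe; rewrite VZe; congr (_ *: _).
have Qyz := QD Qy Qz; have Qxyz : Q (x + (y + z)) by rewrite addrA; exact: QD.
have h1 : V * Z (y + z) = expi (phi x (y + z)) *: Z (x + (y + z)).
  have zy : Z z * Z y = expi (phi z y) *: Z (y + z) by rewrite ZM// addrC.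
  apply: (scalerI (expi_neq0 (phi z y))); rewrite -bop_scaleAr -zy.
  rewrite mulrA Vz bop_scaleAl ZM// !scalerA -!expiD (addrC y z) addrA.
  by congr (expi _ *: _); rewrite phiDl phiDr; ring.
have h2 : V * Z y * Z z = expi (phi y z) *: (V * Z (y + z)).
  by rewrite -mulrA ZM// bop_scaleAr.
apply: (mulIf (expi_neq0 (phi (x + y) z))).
apply: (bop_scale_inj (Zi _ Qxyz) u1); rewrite -!scalerA.
have -> : expi (phi (x + y) z) *: Z (x + (y + z)) = Z (x + y) * Z z.
  by rewrite ZM// addrA.
rewrite -bop_scaleAl -VZe h2 h1 ZM// !scalerA -!expiD addrA.
by congr (expi _ *: _); rewrite phiDl phiDr; ring.
Qed.

(** The multiplier relation is checked after right multiplication by [Z z] with [z] far inside Q.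
    For continuity at [x], boundary points included, the test vector is [Z y u]: there [V t] takes
    the value [expi (phi t y) *: Z (t + y) u], and [t + y] stays in Q. *)
Lemma extension : exists V : 'cV[R]_d -> boundedOp H,
  [/\ forall x, P x -> implements (V x) (alpha x),
      forall x y, P x -> P y -> V x * V y = expi (phi x y) *: V (x + y) &
      strongly_continuous_on P V].
Proof.
have /choice[V VP] : forall x, exists V, P x -> implements V (alpha x) /\
    forall y, Q y -> Q (x + y) -> V * Z y = expi (phi x y) *: Z (x + y).
  move=> x; have [Px|nPx] := pselect (P x); last by exists 0.
  by have [V VP] := extension_pointwise Px; exists V.
have Vi x : P x -> implements (V x) (alpha x) by move=> /VP[].
have VZ x y : P x -> Q y -> Q (x + y) -> V x * Z y = expi (phi x y) *: Z (x + y).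
  by move=> /VP[_]; apply.
exists V; split=> // [x y Px Py|xi].
  have Pxy : P (x + y) by exact: coneD.
  have [] := implements_unique u1 (implementsD alphaE Px Py (Vi x Px) (Vi y Py)) (Vi _ Pxy).
  set c := inner _ _ => c1 VVc; rewrite VVc; congr (_ *: _).
  have [z1 Qz1 Qyz1] := Q_absorb y; have [z2 Qz2 Qxyz2] := Q_absorb (x + y).
  (* A single [z] for which [z], [y + z] and [x + y + z] all lie in Q. *)
  pose z := z1 + z2; have Qz : Q z := QD Qz1 Qz2.
  have Qyz : Q (y + z) by rewrite addrA; exact: QD.
  have Qxyz : Q (x + (y + z)).
    by rewrite [z]addrC addrA addrA -[x + y + z2]addrA addrA; exact: QD.
  apply: (mulIf (expi_neq0 (phi (x + y) z))).
  apply: (bop_scale_inj (Z_impl Qxyz).1 u1).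
  rewrite -scalerA addrA -VZ// -?addrA// -bop_scaleAl -VVc -mulrA VZ//.
  rewrite bop_scaleAr VZ// !scalerA -!expiD.
  by congr (expi _ *: _); rewrite phiDl phiDr; ring.
apply/subspace_continuousP => x Px.
have [y Qy Qn] := Q_near x; have Qxy := nbhs_singleton Qn.
pose m := Z y u; have m1 : `|m| = 1 by rewrite (Z_impl Qy).1.
have Pn : \forall t \near within P (nbhs x), P t by apply: (@filterE _ (nbhs x)).
have Qn' : \forall t \near within P (nbhs x), Q (t + y).
  by apply: filterS Qn => t Qt _.
apply: (implements_cvg m1 (a := alpha) (b := alpha x)).
- by move: Pn; apply: filterS => t /Vi.
- exact: Vi.
- by move=> T w; exact: alpha_strong_cvg.
have -> : V x m = expi (phi x y) *: Z (x + y) u.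
  by rewrite -bop_scaleE -VZ.
have c1 : expi (phi t y) *: Z (t + y) u @[t --> within P (nbhs x)] -->
    expi (phi x y) *: Z (x + y) u.
  apply: cvgZ.
    by apply: cvg_expi; apply: cvg_within_filter; exact: phi_continuous.
  have h : t + y @[t --> within P (nbhs x)] --> within Q (nbhs (x + y)).
    move=> A; rewrite /within /= => QA.
    have ty : t + y @[t --> x] --> x + y.
      by apply: (@cvgD _ _ _ _ (nbhs_filter x)) => //; exact: cvg_cst.
    by move: (ty _ QA) Qn; near_simpl; apply: filterS2 => t QA' Qt _; apply: QA'.
  exact: (@cvg_comp _ _ _ (fun t => t + y) (fun z => Z z u) _ _ _ h (@Z_cvg _ u Qxy)).
apply: cvg_trans c1; apply: near_eq_cvg.
move: Pn Qn'; apply: filterS2 => t Pt Qt.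
by rewrite -bop_scaleE -VZ.
Qed.

End Extension.

Section Simplicial.
Context {R : realType} {d : nat} {H : hilbertType R}.
Variables (P : set 'cV[R]_d) (alpha : 'cV[R]_d -> boundedOp H -> boundedOp H).
Hypothesis P_cone : convex_cone P.
Hypothesis P_spanning : spanning P.
Hypothesis alphaE : E_semigroup P alpha.
Variables (u : H) (U : 'cV[R]_d -> boundedOp H).
Hypothesis u1 : `|u| = 1.
Hypothesis U_impl : forall x, P x -> implements (U x) (alpha x).
Hypothesis U_pos : forall x, P x -> 0 <= inner (U x u) u.

Lemma implements_ordered_prod (b : nat -> 'cV[R]_d) (W : nat -> R -> boundedOp H)
    n (a : nat -> R) : (forall i, P (b i)) ->
  (forall i t, 0 <= t -> implements (W i t) (alpha (t *: b i))) ->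
  (forall i, 0 <= a i) ->
  P (\sum_(0 <= i < n) a i *: b i) /\
  implements (ordered_prod W n a) (alpha (\sum_(0 <= i < n) a i *: b i)).
Proof.
move=> Pb Wi a0; elim: n => [|n [Ps IH]].
  rewrite /ordered_prod !big_nil (implements0 alphaE); split; first exact: cone0.
  exact: implements_id.
have Pn : P (a n *: b n) by exact: (coneZ P_cone).
rewrite ordered_prodS big_nat_recr//=; split; first exact: (coneD P_cone).
exact: (implementsD alphaE Ps Pn IH (Wi _ _ (a0 n))).
Qed.

Lemma implementers_cocycle : exists (V : 'cV[R]_d -> boundedOp H) (M : 'M[R]_d),
  [/\ forall x, P x -> implements (V x) (alpha x),
      forall x y, P x -> P y -> V x * V y = expi (dotv (M *m x) y) *: V (x + y) &
      strongly_continuous_on P V].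
Proof.
have [b [co [Pb co_lin co0 co_sum co_delta]]] := cone_basis (cone0 P_cone) P_spanning.
have /choice[W WP] := fun i => ray_semigroup P_cone alphaE u1 U_impl U_pos (Pb i).
have /choice[k kP] : forall ij : nat * nat, exists k, forall s t, 0 <= s -> 0 <= t ->
    commutator u U (s *: b ij.1) (t *: b ij.2) = expi (k * s * t).
  move=> ij.
  exact: (commutator_bicharacter P_cone alphaE u1 U_impl U_pos (Pb ij.1) (Pb ij.2)).
have Wi i t : 0 <= t -> implements (W i t) (alpha (t *: b i)) by have [+ _ _] := WP i; apply.
have W_iso i t : 0 <= t -> is_isometry (W i t) by move=> t0; exact: (Wi i t t0).1.
have W_add i s t : 0 <= s -> 0 <= t -> W i (s + t) = W i s * W i t.
  by have [_ + _] := WP i; apply.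
have W_cvg0 i (y : H) : W i t y @[t --> 0^'+] --> y by have [_ _] := WP i; apply.
have W_comm i j s t : 0 <= s -> 0 <= t ->
    W i s * W j t = expi (k (i, j) * s * t) *: (W j t * W i s).
  move=> s0 t0; rewrite -(kP (i, j) s t s0 t0) /=.
  have Ps := coneZ P_cone s0 (Pb i); have Pt := coneZ P_cone t0 (Pb j).
  exact: (commutatorP alphaE u1 U_impl Ps Pt (Wi _ _ s0) (Wi _ _ t0)).
have coD i x y : co i (x + y) = co i x + co i y.
  by have := co_lin i 1 x y; rewrite scale1r mul1r.
pose phi x y := prod_phase (fun i j => k (i, j)) d (co^~ x) (co^~ y).
have phi_l y : scalar (phi^~ y).
  move=> a p q; rewrite /phi /prod_phase mulr_sumr -big_split; apply: eq_bigr => i _ /=.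
  rewrite mulr_sumr -big_split; apply: eq_bigr => j _ /=.
  by rewrite co_lin; ring.
have phi_r x : scalar (phi x).
  move=> a p q; rewrite /phi /prod_phase mulr_sumr -big_split; apply: eq_bigr => i _ /=.
  rewrite mulr_sumr -big_split; apply: eq_bigr => j _ /=.
  by rewrite co_lin; ring.
pose Q := [set x | forall i, 0 <= co i x].
pose Z x := ordered_prod W d (co^~ x).
have QPZ x : Q x -> P x /\ implements (Z x) (alpha x).
  by move=> Qx; have := implements_ordered_prod d Pb Wi Qx; rewrite -co_sum.
have [M Mphi] := bilinear_dotv phi_l phi_r.
have Q_near (x : 'cV[R]_d) : exists2 y, Q y & \forall t \near x, Q (t + y).
  pose y := \sum_(0 <= j < d) (`|co j x| + 1) *: b j.
  (* The i-th coordinate of [x + y] is at least 1, and those of points t near [x] drop by less than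
     1. *)
  have coy i : (i < d)%N -> co i y = `|co i x| + 1.
    exact: (co_delta (fun i => `|co i x| + 1)).
  exists y => [i|].
    have [id|di] := ltnP i d; last by rewrite co0.
    by rewrite coy// addr_ge0.
  have near_i (i : 'I_d) : \forall t \near x, co i x - 1 < co i t.
    have := @scalar_cV_continuous _ _ _ (co_lin i) x.
    by move=> /cvgr_gt; apply; rewrite ltrBlDr ltrDl.
  have := @filter_forall _ _ _ _ (nbhs_filter x) near_i; apply: filterS => t ht i.
  have [id|di] := ltnP i d; last by rewrite co0.
  rewrite coD coy//; have := ht (Ordinal id) => /= h.
  have := ler_norm (- co i x); rewrite normrN => h'; lra.
have ext := @extension R d H P alpha P_cone alphaE u U u1 U_impl Q Z phi.
have [||x y z|x y z||||x w Qx|V [Vi VV Vc]] := ext _ _ Q_near.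
- by move=> x /QPZ[].
- by move=> x y Qx Qy i; rewrite coD addr_ge0.
- by have := phi_l z 1 x y; rewrite scale1r mul1r.
- by have := phi_r x 1 y z; rewrite scale1r mul1r.
- by move=> y; exact: scalar_cV_continuous (phi_l y).
- by move=> x /QPZ[].
- move=> x y Qx Qy; rewrite /Z (ordered_prodM W_add W_comm)//.
  by congr (_ *: ordered_prod _ _ _); apply/funext => i; rewrite coD.
- apply: (ordered_prod_cvg W_iso W_add W_cvg0 (a := fun t => co^~ t) Qx).
    by apply: (@filterE _ (nbhs x)) => t.
  by move=> i; apply: cvg_within_filter; exact: scalar_cV_continuous.
exists V, M; split=> // x y Px Py.
by rewrite VV// Mphi.
Qed.

End Simplicial.

Lemma normalized_implementer (R : realType) (H : hilbertType R)
    (a : boundedOp H -> boundedOp H) V (u : H) : implements V a ->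
  exists W, implements W a /\ 0 <= inner (W u) u.
Proof.
move=> Va; set c := inner (V u) u; have [c0|c0] := eqVneq c 0.
  by exists V; rewrite -/c c0.
have nc : `|c| != 0 by rewrite normr_eq0.
exists ((c^* / `|c|) *: V); split.
  by apply: implementsZ => //; rewrite normrM norm_conjC normfV normr_id divff.
rewrite bop_scaleE innerZl -/c mulrAC [_ * c]mulrC -normCK.
by rewrite divr_ge0// exprn_ge0.
Qed.

Lemma unit_vector (R : realType) (H : hilbertType R) :
  ~ finite_dimensional H -> exists u : H, `|u| = 1.
Proof.
move=> Hinf; have [[x x0]|H0] := pselect (exists x : H, x != 0).
  by exists (normalize x); exact: norm_normalize.
exfalso; apply: Hinf; exists 0%N, (fun=> 0) => x; exists (fun=> 0).
by rewrite big_ord0; apply/eqP; apply: contra_notT H0 => x0; exists x.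
Qed.

Theorem theorem3p7 (R : realType) (d : nat) (P : set 'cV[R]_d)
  (H : hilbertType R) (alpha : 'cV[R]_d -> boundedOp H -> boundedOp H)
  (P_closed : closed P) (P_convex_cone : convex_cone P)
  (P_spanning : spanning P) (P_pointed : pointed P)
  (H_separable : separable H) (H_infinite : ~ finite_dimensional H)
  (alpha_E_semigroup : E_semigroup P alpha)
  (alpha_compact : forall x, P x -> forall T : boundedOp H,
     compact_operator T -> compact_operator (alpha x T)) :
  exists (V : 'cV[R]_d -> boundedOp H) (A : 'M[R]_d),
    [/\ (forall x, P x -> is_isometry (V x)),
        strongly_continuous_on P V,
        strictly_upper_triangular A,
        (forall x, P x -> forall T : boundedOp H,
           alpha x T = V x * T * adjoint (V x)) &
        (forall x y, P x -> P y ->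
           V x * V y = expi (dotv (A *m x) y) *: V (x + y))].
Proof.
have [u u1] := unit_vector H_infinite.
have /choice[U UP] : forall x, exists V, P x ->
    implements V (alpha x) /\ 0 <= inner (V u) u.
  move=> x; have [Px|nPx] := pselect (P x); last by exists 0.
  have [V Vx] := alpha_implemented P_convex_cone alpha_E_semigroup alpha_compact
    H_separable Px u1.
  by have [W WP] := normalized_implementer u Vx; exists W.
have [V [M [Vi VV Vc]]] := implementers_cocycle P_convex_cone P_spanning
  alpha_E_semigroup u1 (fun x Px => (UP x Px).1) (fun x Px => (UP x Px).2).
have [A [Aup Asym]] := symmetrize M.
(* The phases [expi (q x)] multiply the multiplier by exp(i (q(x) + q(y) - q(x + y))), which removes
   exactly the symmetric form of [M - A] and leaves that of [A]. *)
pose q x := 2^-1 * dotv ((M - A) *m x) x.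
have qD x y : q (x + y) = q x + q y + dotv ((M - A) *m x) y.
  by rewrite /q mulmxDr !dotvDl !dotvDr (Asym y x); field.
have MA x y : dotv (M *m x) y = dotv (A *m x) y + dotv ((M - A) *m x) y.
  by rewrite -dotvDl -mulmxDl addrC subrK.
have Wi x : P x -> implements (expi (q x) *: V x) (alpha x).
  by move=> Px; apply: implementsZ; [exact: norm_expi|exact: Vi].
exists (fun x => expi (q x) *: V x), A; split=> //.
- by move=> x /Wi[].
- move=> xi; apply/subspace_continuousP => x Px; apply: cvgZ.
    apply: cvg_expi; apply: cvg_within_filter; apply: cvgMl_tmp.
    exact: dotv_quadratic_continuous.
  by have /subspace_continuousP/(_ x Px) := Vc xi.
- by move=> x /Wi[].
move=> x y Px Py; rewrite bop_scaleAl bop_scaleAr VV// !scalerA -!expiD.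
by congr (expi _ *: _); rewrite qD MA; ring.
Qed.
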